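(* Let $\mathbb{K}$ be a field and let $d\ge1$, $k\ge 0$ be integers with $k<d$. Then the Veronese module $S_{2,d,k}=\bigoplus_{i\ge0}S_{k+id}$, with $S=\mathbb{K}[x_1,x_2]$, has a pure minimal graded free resolution over $R$, and its Betti numbers are as follows: for $0\le i\le k$, $$\beta_i(S_{2,d,k})=\beta_{i,k+id}(S_{2,d,k})=(k+1-i)\binom{d}{i},$$ and for $i>k$, $$\beta_i(S_{2,d,k})=\beta_{i,k+(i+1)d}(S_{2,d,k})=(i-k)\binom{d}{i+1}$$ (in particular $\beta_i(S_{2,d,k})=0$ for $i\ge d$).
   Context: $S=\mathbb{K}[x_1,x_2]=\bigoplus_{j\ge0}S_j$ with the standard grading. $R=\mathbb{K}[y_0,\dots,y_d]$ is the polynomial ring in $d+1$ variables, each of degree $d$, acting on $S_{2,d,k}$ via $y_i\mapsto x_1^{i}x_2^{d-i}$ (so $R$ maps onto the Veronese subring $\bigoplus_{i\ge0}S_{id}$); elements of $S_{k+id}$ have degree $k+id$. $\beta_{i,j}(M)=\dim_{\mathbb{K}}\operatorname{Tor}^R_i(M,\mathbb{K})_j$ and $\beta_i(M)=\sum_j\beta_{i,j}(M)$. A minimal graded free resolution is pure if for each $i$ all generators of the $i$-th free module have the same degree $d_i$ (with $d_i<d_{i+1}$). *)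

(* Defs.v *)
From HB Require Import structures.
From mathcomp Require Import all_boot all_order all_algebra.
From mathcomp Require Import mpoly.

Set Implicit Arguments.
Unset Strict Implicit.
Unset Printing Implicit Defensive.

Import GRing.Theory.
Local Open Scope ring_scope.

(* Homogeneous elements of degree e of R = K[y_0, ..., y_d], where every y_i   *)
(* has degree d, so that the monomial m has degree d * mdeg m.                 *)
Definition Rhomog (K : fieldType) (d e : nat) (r : {mpoly K[d.+1]}) : bool :=
  all (fun m : 'X_{1..d.+1} => (d * mdeg m)%N == e) (msupp r).

(* Graded R-modules living in nonnegative degrees.                             *)
Record grmodule (K : fieldType) (d : nat) := GrModule {
  gr_mod :> lmodType {mpoly K[d.+1]};
  gr_comp : nat -> gr_mod -> Prop;
  gr_comp0 : forall j, gr_comp j 0;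
  gr_compB : forall j x y, gr_comp j x -> gr_comp j y -> gr_comp j (x - y);
  gr_compZ : forall e j r x,
    Rhomog e r -> gr_comp j x -> gr_comp (e + j)%N (r *: x);
  gr_comp_sum : forall x, exists (N : nat) (f : nat -> gr_mod),
    (forall j, gr_comp j (f j)) /\ x = \sum_(j < N) f j;
  gr_comp_direct : forall (N : nat) (f : nat -> gr_mod),
    (forall j, gr_comp j (f j)) -> \sum_(j < N) f j = 0 ->
    forall j, (j < N)%N -> f j = 0 }.

Section GradedFreeComplexes.
Variables (K : fieldType) (d : nat).
Local Notation R := {mpoly K[d.+1]}.

(* F_i is the module of row vectors 'rV[R]_(fc_rank i), whose p-th basis       *)
(* element has degree fc_deg i p; F_(i+1) -> F_i is v |-> v *m fc_diff i.      *)
Record free_complex := FreeComplex {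
  fc_rank : nat -> nat;
  fc_deg : forall i, 'I_(fc_rank i) -> nat;
  fc_diff : forall i, 'M[R]_(fc_rank i.+1, fc_rank i) }.

Implicit Types (F : free_complex) (M : grmodule K d) (i j n : nat).

(* The map F_0 -> M sending the p-th basis element to eps p.                   *)
Definition augmentation M F (eps : 'I_(fc_rank F 0) -> M)
    (v : 'rV[R]_(fc_rank F 0)) : M :=
  \sum_p v 0 p *: eps p.

(* F is a graded free resolution of M: all maps preserve degrees, and          *)
(* ... -> F_1 -> F_0 -> M -> 0 is exact.                                       *)
Definition graded_free_resolution M F : Prop :=
  (forall i p q e, (e + fc_deg q = fc_deg p)%N -> Rhomog e (fc_diff F i p q)) /\
  (forall i p q, (fc_deg p < fc_deg q)%N -> fc_diff F i p q = 0) /\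
  exists eps : 'I_(fc_rank F 0) -> M,
    [/\ forall p, gr_comp (fc_deg p) (eps p),
        forall x : M, exists v, augmentation eps v = x,
        forall v, augmentation eps v = 0 <-> exists w, v = w *m fc_diff F 0
      & forall i (v : 'rV[R]_(fc_rank F i.+1)),
          v *m fc_diff F i = 0 <-> exists w, v = w *m fc_diff F i.+1].

(* The image of F_(i+1) lies in (y_0, ..., y_d) F_i.                           *)
Definition minimal F : Prop :=
  forall i p q, (fc_diff F i p q)@_0%MM = 0.

Definition pure F : Prop :=
  exists D : nat -> nat,
    (forall i, (D i < D i.+1)%N) /\ (forall i (p : 'I_(fc_rank F i)), fc_deg p = D i).

Definition has_pure_minimal_resolution M : Prop :=
  exists F, [/\ graded_free_resolution M F, minimal F & pure F].

(* F_i (x)_R K is the space of row vectors 'rV[K]_(fc_rank F i), where          *)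
(* K = R / (y_0, ..., y_d): entries of R are replaced by constant terms.        *)
Definition diffK F i : 'M[K]_(fc_rank F i.+1, fc_rank F i) :=
  map_mx (mcoeff 0%MM) (fc_diff F i).

(* The map out of F_i (x) K, which is 0 for i = 0.                             *)
Definition diffK_out F i : 'M[K]_(fc_rank F i, fc_rank F i.-1) :=
  match i return 'M[K]_(fc_rank F i, fc_rank F i.-1) with
  | 0 => 0
  | i'.+1 => diffK F i'
  end.

(* A matrix whose row space is the degree j part of F_i (x) K.                 *)
Definition compK F i j : 'M[K]_(fc_rank F i) :=
  diag_mx (\row_p (fc_deg p == j)%:R).

Definition cyclesK F i j : 'M[K]_(fc_rank F i) :=
  (compK F i j :&: kermx (diffK_out F i))%MS.

Definition boundariesK F i j : 'M[K]_(fc_rank F i.+1, fc_rank F i) :=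
  compK F i.+1 j *m diffK F i.

(* Dimension of the degree j part of the i-th homology of F (x)_R K; for a     *)
(* resolution F the boundaries are contained in the cycles, and A :\: B is a   *)
(* complement of A :&: B in A, so its rank is that of the quotient space.       *)
Definition dim_homologyK F i j : nat :=
  \rank (cyclesK F i j :\: boundariesK F i j)%MS.

(* b = dim_K Tor^R_i(M, K)_j, computed from any graded free resolution of M;   *)
(* the first clause keeps the second one from holding vacuously.                *)
Definition is_betti M i j (b : nat) : Prop :=
  (exists F, graded_free_resolution M F) /\
  (forall F, graded_free_resolution M F -> dim_homologyK F i j = b).

(* b is the sum over all j of the (i, j) Betti numbers of M, finitely many of  *)
(* which are nonzero.                                                          *)
Definition is_total_betti M i (b : nat) : Prop :=
  exists (bt : nat -> nat) (N : nat),
    [/\ forall j, is_betti M i j (bt j),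
        forall j, (N <= j)%N -> bt j = 0%N
      & b = (\sum_(j < N) bt j)%N].

End GradedFreeComplexes.

(* S = K[x_1, x_2], to be viewed as a module over K[y_0, ..., y_d].            *)
Definition S_over_R (K : fieldType) (d : nat) : Type := {mpoly K[2]}.
HB.instance Definition _ (K : fieldType) (d : nat) :=
  GRing.Zmodule.copy (S_over_R K d) {mpoly K[2]}.

Section VeroneseModule.
Variables (K : fieldType) (d : nat).
Local Notation R := {mpoly K[d.+1]}.
Local Notation S := (S_over_R K d).

(* The images x_1^i x_2^(d-i) of the y_i, with x_1 = 'X_ord0, x_2 = 'X_ord_max *)
Definition veronese_monomials : d.+1.-tuple {mpoly K[2]} :=
  [tuple 'X_ord0 ^+ i * 'X_ord_max ^+ (d - i) | i < d.+1].

Definition S_scale (r : R) (s : S) : S :=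
  (r \mPo veronese_monomials) * (s : {mpoly K[2]}).

Fact S_scaleA (a b : R) (s : S) :
  S_scale a (S_scale b s) = S_scale (a * b) s.
Proof. by rewrite /S_scale rmorphM mulrA. Qed.

Fact S_scale1 : left_id 1 S_scale.
Proof. by move=> s; rewrite /S_scale rmorph1 mul1r. Qed.

Fact S_scaleDr : right_distributive S_scale +%R.
Proof. by move=> r s t; rewrite /S_scale mulrDr. Qed.

Fact S_scaleDl (s : S) : {morph S_scale^~ s : a b / a + b}.
Proof. by move=> a b; rewrite /S_scale rmorphD mulrDl. Qed.

HB.instance Definition _ := GRing.Zmodule_isLmodule.Build R S
  S_scaleA S_scale1 S_scaleDr S_scaleDl.

Fact veronese_monomials_homog i : tnth veronese_monomials i \is d.-homog.
Proof.
have h1 j n : ('X_j ^+ n : {mpoly K[2]}) \is n.-homog.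
  by rewrite -[n in ishomog1 n]mul1n dhomogMn // dhomogX; apply/eqP/mdeg1.
rewrite tnth_mktuple -[X in ishomog1 X](subnKC (ltn_ord i : (i <= d)%N)).
by apply: dhomogM; apply: h1.
Qed.

Fact comp_veronese_homog e (r : R) :
  Rhomog e r -> (r \mPo veronese_monomials) \is e.-homog.
Proof.
move=> /allP hr; rewrite comp_mpolyEX big_seq; apply: rpred_sum => m /hr /eqP <-.
apply: rpredZ; rewrite comp_mpolyX mdegE big_distrr /=.
elim/big_rec2: _ => [|i a b _ hab]; first exact: dhomog1.
by apply: dhomogM => //; apply: dhomogMn; apply: veronese_monomials_homog.
Qed.

Fact comp_veronese_dvdn (r : R) m :
  m \in msupp (r \mPo veronese_monomials) -> (d %| mdeg m)%N.
Proof.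
rewrite comp_mpolyEX => /msupp_sum_le /flattenP [ms] /mapP [n _ ->] /msuppZ_le.
have /comp_veronese_homog /dhomogP h : Rhomog (d * mdeg n) ('X_[n] : R).
  by rewrite /Rhomog msuppX /= eqxx.
by move=> /h ->; apply: dvdn_mulr.
Qed.

Variable k : nat.

(* All terms of s have degree k + i d for some i >= 0.                         *)
Definition veronese_pred : {pred S} :=
  fun s => all (fun m : 'X_{1..2} => (k <= mdeg m)%N && (d %| mdeg m - k)%N)
             (msupp (s : {mpoly K[2]})).

Fact veronese_submod_closed : submod_closed veronese_pred.
Proof.
split=> [|r s t /allP hs /allP ht]; first by rewrite unfold_in /= msupp0.
apply/allP=> m /msuppD_le; rewrite mem_cat => /orP[|/ht //].
case/msuppM_le/allpairsP=> -[m1 m2] /= [hm1 /hs /andP[k2 d2] ->].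
rewrite mdegD -addnBA // dvdn_add ?(leq_trans k2) ?leq_addl //.
exact: comp_veronese_dvdn hm1.
Qed.

HB.instance Definition _ := GRing.isSubmodClosed.Build R S veronese_pred
  veronese_submod_closed.

(* The direct sum of the S_(k + i d), i >= 0.                                  *)
Record veronese_type := Veronese
  { veronese_val : S; _ : veronese_val \in veronese_pred }.

HB.instance Definition _ := [isSub for veronese_val].
HB.instance Definition _ := [Choice of veronese_type by <:].
HB.instance Definition _ := [SubChoice_isSubLmodule of veronese_type by <:].

Fact veronese_val_is_linear : linear veronese_val.
Proof. by []. Qed.

HB.instance Definition _ := GRing.isLinear.Build R veronese_type S _ veronese_val
  veronese_val_is_linear.

Definition veronese_comp (j : nat) (x : veronese_type) : Prop :=
  (veronese_val x : {mpoly K[2]}) \is j.-homog.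

Fact veronese_comp0 j : veronese_comp j 0.
Proof. by rewrite /veronese_comp raddf0; apply: dhomog0. Qed.

Fact veronese_compB j x y :
  veronese_comp j x -> veronese_comp j y -> veronese_comp j (x - y).
Proof. by rewrite /veronese_comp raddfB /= => hx hy; apply: rpredB. Qed.

Fact veronese_compZ e j (r : R) x :
  Rhomog e r -> veronese_comp j x -> veronese_comp (e + j) (r *: x).
Proof.
move=> /comp_veronese_homog hr hx; rewrite /veronese_comp linearZ.
exact: dhomogM hr hx.
Qed.

Fact veronese_comp_sum x : exists (N : nat) (f : nat -> veronese_type),
  (forall j, veronese_comp j (f j)) /\ x = \sum_(j < N) f j.
Proof.
pose p : {mpoly K[2]} := veronese_val x.
have hp j : (pihomog mdeg j p : S) \in veronese_pred.
  apply/allP=> m /(msupp_sum_le) /flattenP [ms] /mapP [n].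
  rewrite mem_filter => /andP[_ hn] -> /msuppZ_le /mem_msuppXP <-.
  by have /allP := valP x; apply.
exists (mmeasure mdeg p), (fun j => Veronese (hp j)); split=> [j|].
  exact: pihomogP.
apply: val_inj; rewrite raddf_sum /=.
exact: (pihomog_partitionE (leqnn (mmeasure mdeg p))).
Qed.

Fact veronese_comp_direct (N : nat) (f : nat -> veronese_type) :
  (forall j, veronese_comp j (f j)) -> \sum_(j < N) f j = 0 ->
  forall j, (j < N)%N -> f j = 0.
Proof.
move=> hf /(congr1 (@veronese_val)); rewrite raddf_sum raddf0 /= => h0 j jN.
apply: val_inj => /=.
have := congr1 (pihomog mdeg j) h0.
rewrite raddf_sum /= raddf0 (bigD1 (Ordinal jN)) //= pihomog_dE; last exact: hf.
rewrite big1 ?addr0 // => i ij; apply: (pihomog_ne0 (d := i)); last exact: hf.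
by apply: contra ij => /eqP ij; apply/eqP/val_inj.
Qed.

Definition veronese : grmodule K d :=
  GrModule veronese_comp0 veronese_compB veronese_compZ
    veronese_comp_sum veronese_comp_direct.

End VeroneseModule.

(* Main.v *)
(* Put f_s = y_(s+1) - z y_s for 0 <= s < d, with z = x_1 / x_2. The Koszul     *)
(* complex of these elements over R[z] splits into strands according to the    *)
(* degree in x_1, x_2. Its differential is k_1 - z k_0, where k_0 and k_1 are   *)
(* the anticommuting Koszul differentials of (y_0, ..., y_(d-1)) and           *)
(* (y_1, ..., y_d), both exact because they come from sequences of variables.  *)
(* The resolution consists of the part of non-negative powers of z in position *)
(* i <= k (z^0, ..., z^(k-i) with the i-th exterior power), of the part of the *)
(* negative powers z^(-1), ..., z^(k-i) with the (i+1)-st exterior power in    *)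
(* position i > k, and of the quadratic map k_1 k_0 joining them. A cycle of a *)
(* strand is a boundary over R[z] because k_1 is exact, coefficient by         *)
(* coefficient; exactness of k_0 then lowers the z-degree of the lift.         *)
(* The Betti numbers are read off this minimal complex: comparing an arbitrary *)
(* graded resolution with it, up to homotopy and degree by degree, gives the   *)
(* homology of the former tensored with K.                                      *)

Require Import Defs.
From HB Require Import structures.
From mathcomp Require Import all_boot all_order all_algebra zify ring.
From mathcomp Require Import mpoly.

Set Implicit Arguments.
Unset Strict Implicit.
Unset Printing Implicit Defensive.

Import GRing.Theory.
Local Open Scope ring_scope.

(** * The Koszul complex of a sequence of variables *)

(** Each f_s = y_(s+1) - z y_s vanishes under y_i = x_1^i x_2^(d-i), z = x_1 / x_2, so the module is
    the quotient of the polynomials in z of degree at most k over R by the multiples of the f_s that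
    stay in that range. The complex resolving it is the k-th member of the Eagon-Northcott family of
    the 2 x d matrix with rows y_0, ..., y_(d-1) and y_1, ..., y_d.

    Its exactness rests on one explicit contraction, [koszul_homotopy], valid for any sequence of
    distinct variables. [strand_solve] lifts a cycle one power of z at a time, a weight argument
    making this finite; [strand_trunc] then brings the z-degree of the lift down to the right bound,
    and [dual_strand_exact] handles the negative powers. These combine into [vdiff_exact] and, at
    the augmentation, [ev_exact].

    The matrix entries are linear or quadratic forms and the generators in each position share one
    degree, so the resolution is minimal and pure; [vrankE] counts its ranks. Betti numbers are
    defined through all graded resolutions, and [dim_homologyK_minimal] shows that each of them
    gives the ranks of a minimal one. *)

Section Koszul.
Variables (A : comNzRingType) (d : nat).
Implicit Types (y z : 'I_d -> A) (J : {set 'I_d}) (s t : 'I_d).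
Local Notation L := {ffun {set 'I_d} -> A}.
Implicit Types (c b : L).

Definition ksgn s J : A := (-1) ^+ #|[set r in J | (r < s)%N]|.

Definition kos y c : L :=
  [ffun J : {set 'I_d} => \sum_(s | s \notin J) ksgn s J * (y s * c (s |: J))].

Lemma kos_is_additive y : zmod_morphism (kos y).
Proof.
move=> b c; apply/ffunP=> J; rewrite !ffunE -sumrB; apply: eq_bigr => s _.
by rewrite !ffunE mulrBr mulrBr.
Qed.

HB.instance Definition _ y := GRing.isZmodMorphism.Build L L (kos y)
  (kos_is_additive y).

Lemma ksgn_setU s t J : s \notin J -> t \notin J -> s != t ->
  ksgn t (s |: J) = (if (s < t)%N then -1 else 1) * ksgn t J.
Proof.
move=> sJ tJ st; rewrite /ksgn; case: ifPn => lst.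
  rewrite (_ : [set r in s |: J | _] = s |: [set r in J | (r < t)%N]).
    by rewrite cardsU1 inE (negbTE sJ) /= exprS.
  apply/setP=> r; rewrite !inE; case: eqP => [->|] //=.
rewrite mul1r; congr (_ ^+ _); apply: eq_card => r; rewrite !inE.
by case: eqP => [->|] //=; rewrite (negbTE lst) (negbTE sJ).
Qed.

Lemma ksgn_anti s t J : s \notin J -> t \notin J -> s != t ->
  ksgn s J * ksgn t (s |: J) = - (ksgn t J * ksgn s (t |: J)).
Proof.
move=> sJ tJ st; rewrite !ksgn_setU //; last by rewrite eq_sym.
have : (s < t)%N || (t < s)%N by rewrite -neq_ltn.
case: ltngtP => //= _ _; ring.
Qed.

Lemma kos2E y z c J : kos y (kos z c) J = \sum_s \sum_t
  if [&& s \notin J, t \notin J & s != t] then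
    ksgn s J * ksgn t (s |: J) * (y s * z t * c (t |: (s |: J))) else 0.
Proof.
rewrite ffunE big_mkcond; apply: eq_bigr => s _; case: ifPn => sJ /=; last first.
  by rewrite big1.
rewrite ffunE !mulr_sumr big_mkcond; apply: eq_bigr => t _.
rewrite !inE negb_or eq_sym andbC; case: ifP => // _; ring.
Qed.

Lemma kosC y z c : kos y (kos z c) = - kos z (kos y c).
Proof.
apply/ffunP=> J; rewrite [RHS]ffunE !kos2E exchange_big /= -sumrN.
apply: eq_bigr => s _; rewrite -sumrN; apply: eq_bigr => t _.
rewrite andbCA eq_sym; case: ifPn => [/and3P[sJ tJ st]|_]; last by rewrite oppr0.
by rewrite ksgn_anti // 1?eq_sym // setUCA [y t * _]mulrC mulNr.
Qed.

(** Taking equal arguments in [kosC] shows only that twice the square vanishes, which is void in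
    characteristic 2; the terms of (s, t) and (t, s) are cancelled in pairs instead. *)
Lemma kosK y c : kos y (kos y c) = 0.
Proof.
apply/ffunP=> J; rewrite kos2E [RHS]ffunE.
have split_lt (F : 'I_d -> 'I_d -> A) : (forall s, F s s = 0) ->
    (forall s t, F s t = - F t s) -> \sum_s \sum_t F s t = 0.
  move=> F0 FN.
  have -> : \sum_s \sum_t F s t = \sum_(s < d) \sum_(t < d | (s < t)%N) F s t +
      \sum_(s < d) \sum_(t < d | (t < s)%N) F s t.
    rewrite -big_split; apply: eq_bigr => s _ /=.
    rewrite (bigID (fun t : 'I_d => (s < t)%N)) /=; congr (_ + _).
    rewrite (bigD1 s) ?ltnn //= F0 add0r; apply: eq_bigl => t.
    by rewrite -leqNgt ltn_neqAle andbC.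
  rewrite [X in _ + X](exchange_big_dep predT) //= -big_split big1 //= => s _.
  by rewrite -big_split big1 //= => t _; rewrite FN addNr.
apply: split_lt => [s|s t]; first by rewrite eqxx !andbF.
rewrite andbCA eq_sym; case: ifPn => [/and3P[sJ tJ st]|_]; last by rewrite oppr0.
by rewrite ksgn_anti // 1?eq_sym // setUCA [y s * _]mulrC mulNr.
Qed.

Lemma kosZ y a c : kos y [ffun J => a * c J] = [ffun J => a * kos y c J].
Proof.
by apply/ffunP=> J; rewrite !ffunE mulr_sumr; apply: eq_bigr => s _; rewrite ffunE; ring.
Qed.

Definition exdeg j c := forall J, #|J| != j -> c J = 0.

Lemma exdeg0 j : exdeg j 0.
Proof. by move=> J _; rewrite ffunE. Qed.

Lemma exdegD j b c : exdeg j b -> exdeg j c -> exdeg j (b + c).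
Proof. by move=> hb hc J hJ; rewrite ffunE hb // hc // addr0. Qed.

Lemma exdegN j c : exdeg j c -> exdeg j (- c).
Proof. by move=> hc J hJ; rewrite ffunE hc // oppr0. Qed.

Lemma exdeg_kos j y c : exdeg j.+1 c -> exdeg j (kos y c).
Proof.
move=> hc J hJ; rewrite ffunE big1 // => s sJ.
by rewrite hc ?mulr0 // cardsU1 sJ.
Qed.

End Koszul.

(** * A contracting homotopy for a sequence of variables *)

Section KoszulVariables.
Variables (K : comNzRingType) (n d : nat) (v : 'I_d -> 'I_n).
Hypothesis v_inj : injective v.
Local Notation R := {mpoly K[n]}.
Local Notation L := {ffun {set 'I_d} -> R}.
Implicit Types (p : R) (m : 'X_{1..n}) (s t : 'I_d) (c b : L) (J : {set 'I_d}).

Lemma mcoeffXM (i : 'I_n) p m :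
  ('X_i * p)@_m = if (0 < m i)%N then p@_(m - U_(i)) else 0.
Proof.
case: ifPn => [mi|]; last first.
  rewrite -eqn0Ngt => mi; apply: memN_msupp_eq0; rewrite mulrC (perm_mem (msuppMX _ _)).
  apply/mapP=> -[m' _ /mnmP/(_ i)]; rewrite mnmDE mnm1E eqxx (eqP mi); lia.
rewrite mulrC -[in LHS](submK (m := U_(i)%MM) (m' := m)) 1?addmC ?mcoeffMX //.
by apply/mnm_lepP=> j; rewrite mnm1E; case: eqP => // <-.
Qed.

Definition nodvd (k : nat) m := [forall r : 'I_d, (r < k)%N ==> (m (v r) == 0%N)].

(* The part of [p] in which [v s] is the first of the variables to occur,      *)
(* divided by that variable.                                                   *)
Definition divvar s p : R :=
  \sum_(m <- msupp p | (0 < m (v s))%N && nodvd s m) p@_m *: 'X_[m - U_(v s)].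

Lemma mcoeff_divvar s p m :
  (divvar s p)@_m = if nodvd s m then p@_(m + U_(v s)) else 0.
Proof.
rewrite raddf_sum /=.
under eq_bigr => m' _ do rewrite mcoeffZ mcoeffX.
have nodvdD m' : nodvd s (m' + U_(v s)) = nodvd s m'.
  apply: eq_forallb => r; case: ltnP => //= rs; rewrite mnmDE mnm1E.
  by case: (v s =P v r) => [/v_inj sr|_]; [move: rs; rewrite sr ltnn | rewrite addn0].
have eqm m' : (0 < m' (v s))%N -> ((m' - U_(v s))%MM == m) = (m' == (m + U_(v s))%MM).
  move=> ms; apply/eqP/eqP => [<-|->]; last by rewrite addmK.
  by rewrite submK //; apply/mnm_lepP=> j; rewrite mnm1E; case: eqP => // <-.
case: (boolP ((m + U_(v s))%MM \in msupp p)) => [ms|ms]; last first.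
  rewrite (memN_msupp_eq0 ms) if_same big_seq_cond big1 // => m' /and3P[m's m'0 _].
  rewrite eqm //; case: eqP => [E|_]; last by rewrite mulr0.
  by rewrite -E m's in ms.
rewrite big_mkcond (bigD1_seq _ ms) ?msupp_uniq //= mnmDE mnm1E eqxx addn1 /= nodvdD.
rewrite addmK eqxx mulr1 [X in _ + X]big1 ?addr0 // => m' m'm.
by case: ifP => // /andP[m'0 _]; rewrite eqm // (negbTE m'm) mulr0.
Qed.

Lemma divvar_is_additive s : zmod_morphism (divvar s).
Proof.
move=> p q; apply/mpolyP=> m; rewrite mcoeffB !mcoeff_divvar.
by case: ifP => _; rewrite ?mcoeffB ?subr0.
Qed.

HB.instance Definition _ s := GRing.isZmodMorphism.Build R R (divvar s)
  (divvar_is_additive s).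

Lemma divvarX_lt s t p : (s < t)%N -> divvar t ('X_(v s) * p) = 0.
Proof.
move=> st; apply/mpolyP=> m; rewrite mcoeff_divvar mcoeff0; case: ifP => // /forallP.
move=> /(_ s); rewrite st /= mcoeffXM mnmDE mnm1E => /eqP ->.
by case: (v t =P v s) => [/v_inj ts|_]; [rewrite ts ltnn in st | ].
Qed.

Lemma divvarX_gt s t p : (t < s)%N ->
  divvar t ('X_(v s) * p) = 'X_(v s) * divvar t p.
Proof.
move=> ts; apply/mpolyP=> m; rewrite mcoeffXM !mcoeff_divvar mcoeffXM.
have vst : (v t == v s) = false.
  by apply/eqP=> /v_inj E; move: ts; rewrite E ltnn.
rewrite mnmDE mnm1E vst addn0.
have -> : nodvd t (m - U_(v s)) = nodvd t m.
  apply: eq_forallb => r; case: ltnP => //= rt; rewrite mnmBE mnm1E.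
  case: (v s =P v r) => [/v_inj E|_]; last by rewrite subn0.
  by move: rt; rewrite -E; lia.
case: ifP => _; case: ifP => // ms; congr (_@__).
apply/mnmP=> j; rewrite !(mnmBE, mnmDE, mnm1E).
by case: (v s =P j) => [<-|_]; [rewrite vst; lia | rewrite !subn0].
Qed.

Lemma divvar_mcoeff s p m :
  ('X_(v s) * divvar s p)@_m = if (0 < m (v s))%N && nodvd s m then p@_m else 0.
Proof.
rewrite mcoeffXM mcoeff_divvar; case: ifP => //= ms.
have -> : nodvd s (m - U_(v s)) = nodvd s m.
  apply: eq_forallb => r; case: ltnP => //= rt; rewrite mnmBE mnm1E.
  case: (v s =P v r) => [/v_inj E|_]; last by rewrite subn0.
  by move: rt; rewrite -E ltnn.
case: ifP => // _; rewrite submK //.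
by apply/mnm_lepP=> j; rewrite mnm1E; case: eqP => // <-.
Qed.

Lemma mcoeff_sum_divvar k p m :
  (\sum_(s < d | (s < k)%N) 'X_(v s) * divvar s p)@_m =
  if nodvd k m then 0 else p@_m.
Proof.
rewrite raddf_sum (eq_bigr _ (fun s _ => divvar_mcoeff s p m)).
case: ifPn => [/forallP nk|].
  by rewrite big1 // => s sk; move: (nk s); rewrite sk /= => /eqP ->.
rewrite negb_forall => /existsP[s1]; rewrite negb_imply => /andP[s1k ms1].
case: (arg_minnP (fun s : 'I_d => s : nat) (P := fun s => m (v s) != 0%N) ms1).
move=> s0 ms0 min_s0; rewrite (bigD1 s0) ?(leq_ltn_trans _ s1k) ?min_s0 //=.
rewrite lt0n ms0 /= (_ : nodvd _ _); last first.
  apply/forallP=> r; apply/implyP; apply: contraTT => mr; rewrite -leqNgt.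
  exact: min_s0.
rewrite big1 ?addr0 // => s /andP[_ ss0]; case: ifP => // /andP[ms /forallP].
move=> /(_ s0); rewrite (negbTE ms0) implybF -leqNgt leq_eqVlt.
rewrite -lt0n in ms0; have := min_s0 s; rewrite -lt0n ms => /(_ isT) s0s.
by rewrite ltnNge s0s orbF => /eqP /val_inj E; rewrite E eqxx in ss0.
Qed.

Lemma divvar_partition t p :
  \sum_(s < d | (s < t)%N) 'X_(v s) * divvar s p + divvar t ('X_(v t) * p) = p.
Proof.
apply/mpolyP=> m; rewrite mcoeffD mcoeff_sum_divvar mcoeff_divvar mcoeffXM.
by rewrite mnmDE mnm1E eqxx addn1 /= addmK; case: ifP; rewrite ?add0r ?addr0.
Qed.

Definition khom c : L := [ffun J : {set 'I_d} =>
  \sum_(t in J | [forall r in J, (t <= r)%N]) divvar t (c (J :\ t))].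

Lemma khom0 c : khom c set0 = 0.
Proof. by rewrite ffunE big_pred0 // => t; rewrite inE. Qed.

Lemma khom_min c J t : t \in J -> (forall r, r \in J -> (t <= r)%N) ->
  khom c J = divvar t (c (J :\ t)).
Proof.
move=> tJ tmin; rewrite ffunE (big_pred1 t) // => s /=.
apply/andP/eqP => [[sJ /forall_inP smin]|->].
  by apply/val_inj/anti_leq; rewrite tmin //= smin.
by split=> //; apply/forall_inP.
Qed.

Local Notation kosv := (kos (fun s => 'X_(v s) : R)).

Lemma divvar_ksgn t s J p : divvar t (ksgn {mpoly K[n]} s J * p) = ksgn _ s J * divvar t p.
Proof. by rewrite /ksgn -signr_odd !mulr_sign; case: odd => //; rewrite raddfN. Qed.

(** Let t be the least element of J. The indices s < t in [kosv (khom c)] collect the part of [c J]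
    divisible by an earlier variable, and the index t in [khom (kosv c)] supplies the rest, by
    [divvar_partition]; indices above t cancel between the summands. At J = [set0] only the first
    summand is left, and it misses exactly the monomials that the hypothesis excludes. *)
Lemma koszul_homotopy c : (forall m, (forall s, m (v s) = 0%N) -> (c set0)@_m = 0) ->
  kosv (khom c) + khom (kosv c) = c.
Proof.
move=> c0; apply/ffunP=> J; rewrite [LHS]ffunE.
have [->|[t0 t0J]] := set_0Vmem J.
  rewrite khom0 addr0 ffunE; apply/mpolyP=> m.
  under eq_bigr => s _.
    rewrite (@khom_min _ _ s) ?setU11 //; last first.
      by move=> r; rewrite !inE orbF => /eqP ->.
    rewrite setU1K ?inE // /ksgn (_ : [set _ in _ | _] = set0); last first.
      by apply/setP=> r; rewrite !inE.
    rewrite cards0 mul1r; over.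
  rewrite (eq_bigl (fun s : 'I_d => s < d)%N); last by move=> s; rewrite inE ltn_ord.
  rewrite mcoeff_sum_divvar; case: ifP => // /forallP nm; rewrite c0 // => s.
  by apply/eqP; have := nm s; rewrite ltn_ord.
case: (arg_minnP (fun s : 'I_d => s : nat) t0J) => t {}t0J tmin {t0}.
have tJ : t \in J by [].
rewrite (khom_min _ tJ) // ffunE [kosv c _]ffunE raddf_sum /=.
have tJt : t \notin J :\ t by rewrite !inE eqxx.
rewrite [X in _ + X](bigD1 t) //= setD1K // addrCA -[RHS](divvar_partition t (c J)) [RHS]addrC.
rewrite divvar_ksgn (_ : ksgn _ t (J :\ t) = 1) ?mul1r; last first.
  rewrite /ksgn (_ : [set _ in _ | _] = set0) ?cards0 //; apply/setP=> r; rewrite !inE.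
  by apply/negP=> /andP[/andP[_ /tmin]]; rewrite ltnNge => ->.
congr (_ + _); rewrite [X in _ + X](eq_bigl (fun s => s \notin J)); last first.
  move=> s; rewrite in_setD1 negb_and negbK.
  by case: (s =P t) => [->|_]; rewrite ?tJ ?andbT.
rewrite -big_split /= big_mkcond [RHS]big_mkcond; apply: eq_bigr => s _ /=.
case: ifPn => [sJ|/negPn sJ]; last by rewrite ltnNge tmin.
have st : s != t by apply: contraNneq sJ => ->.
rewrite divvar_ksgn; case: ltnP => lst.
  rewrite divvarX_lt // mulr0 addr0 (@khom_min _ _ s) ?setU11 //; last first.
    by move=> r; rewrite in_setU1 => /predU1P[->//|/tmin tr]; apply: leq_trans tr; apply: ltnW.
  rewrite setU1K // /ksgn (_ : [set _ in _ | _] = set0) ?cards0 ?mul1r //.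
  apply/setP=> r; rewrite !inE; apply/negP=> /andP[/tmin tr rs].
  by have := leq_trans (ltn_trans rs lst) tr; rewrite ltnn.
have lts : (t < s)%N by rewrite ltn_neqAle lst andbT eq_sym.
have sJt : s \notin J :\ t by rewrite !inE negb_and sJ orbT.
rewrite divvarX_gt // (@khom_min _ _ t) ?in_setU1 ?tJ ?orbT //; last first.
  by move=> r; rewrite in_setU1 => /predU1P[->|/tmin //]; apply: ltnW.
rewrite (_ : (s |: J) :\ t = s |: (J :\ t)); last first.
  by apply/setP=> r; rewrite !inE; case: (r =P s) => [->|]; rewrite ?st.
rewrite -{1}(setD1K tJ) ksgn_setU // 1?eq_sym // lts mulN1r mulNr addNr //.
Qed.

Lemma khomz : khom 0 = 0.
Proof.
by apply/ffunP=> J; rewrite !ffunE big1 // => t _; rewrite ffunE raddf0.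
Qed.

Lemma msupp_kosv c J m : m \in msupp (kosv c J) ->
  exists s m', [/\ s \notin J, m' \in msupp (c (s |: J)) & m = (U_(v s) + m')%MM].
Proof.
rewrite ffunE => /msupp_sum_le /flattenP[ms /mapP[s]].
rewrite mem_filter => /andP[sJ _] -> h.
have {h} : m \in msupp ('X_(v s) * c (s |: J)).
  by move: h; rewrite /ksgn -signr_odd mulr_sign; case: odd; rewrite ?(perm_mem (msuppN _)).
by rewrite mulrC (perm_mem (msuppMX _ _)) => /mapP[m' hm' ->]; exists s, m'.
Qed.

Lemma exdeg_khom j c : exdeg j c -> exdeg j.+1 (khom c).
Proof.
move=> hc J hJ; rewrite ffunE big1 // => t /andP[tJ _].
rewrite hc ?raddf0 //; apply: contraNneq hJ => <-.
by rewrite (cardsD1 t J) tJ.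
Qed.

Lemma koszul_exact j c : (0 < j)%N -> exdeg j c -> kosv c = 0 -> c = kosv (khom c).
Proof.
move=> j0 cj c0; rewrite -[LHS]koszul_homotopy ?c0 ?khomz ?addr0 //.
by move=> m _; rewrite cj ?mcoeff0 // cards0 neq_ltn j0.
Qed.

End KoszulVariables.

(** * Exactness of the strands *)

Section Strands.
Variables (K : comNzRingType) (d : nat).
Local Notation R := {mpoly K[d.+1]}.
Local Notation L := {ffun {set 'I_d} -> R}.
Implicit Types (m : 'X_{1..d.+1}) (s t : 'I_d) (J : {set 'I_d}) (b c e : L).
Implicit Types (bs cs : nat -> L) (j n M N W : nat).

Definition vlo : 'I_d -> 'I_d.+1 := widen_ord (leqnSn d).
Definition vhi : 'I_d -> 'I_d.+1 := lift ord0.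

Lemma vlo_inj : injective vlo.
Proof. by move=> s t /(congr1 val) /= /val_inj. Qed.

Lemma vhi_inj : injective vhi.
Proof. exact: lift_inj. Qed.

(* Locked, since unification is slow to tell [kos0] and [kos1] apart.          *)
Fact kos0_key : unit. Proof. exact: tt. Qed.
Fact kos1_key : unit. Proof. exact: tt. Qed.
Definition kos0 : L -> L := locked_with kos0_key (kos (fun s => 'X_(vlo s))).
Definition kos1 : L -> L := locked_with kos1_key (kos (fun s => 'X_(vhi s))).

Lemma kos0E : kos0 = kos (fun s => 'X_(vlo s)). Proof. exact: unlock. Qed.
Lemma kos1E : kos1 = kos (fun s => 'X_(vhi s)). Proof. exact: unlock. Qed.

Fact kos0_is_additive : zmod_morphism kos0.
Proof. by rewrite kos0E; apply: raddfB. Qed.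
Fact kos1_is_additive : zmod_morphism kos1.
Proof. by rewrite kos1E; apply: raddfB. Qed.
HB.instance Definition _ := GRing.isZmodMorphism.Build L L kos0 kos0_is_additive.
HB.instance Definition _ := GRing.isZmodMorphism.Build L L kos1 kos1_is_additive.

Lemma kos01 c : kos0 (kos1 c) = - kos1 (kos0 c).
Proof. by rewrite kos0E kos1E kosC. Qed.
Lemma kos00 c : kos0 (kos0 c) = 0. Proof. by rewrite kos0E kosK. Qed.
Lemma kos11 c : kos1 (kos1 c) = 0. Proof. by rewrite kos1E kosK. Qed.

Lemma exdeg_kos0 j c : exdeg j.+1 c -> exdeg j (kos0 c).
Proof. by rewrite kos0E; apply: exdeg_kos. Qed.
Lemma exdeg_kos1 j c : exdeg j.+1 c -> exdeg j (kos1 c).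
Proof. by rewrite kos1E; apply: exdeg_kos. Qed.

Lemma kos0_exact j c : exdeg j.+1 c -> kos0 c = 0 ->
  exists2 e, exdeg j.+2 e & c = kos0 e.
Proof.
rewrite kos0E; exists (khom vlo c); first exact: (exdeg_khom vlo_inj).
exact: (koszul_exact vlo_inj (ltn0Sn j)).
Qed.

(* [bs] stands for the polynomial [\sum_a bs a z^a], and [bd] for the Koszul    *)
(* differential of the elements [y_(s+1) - z y_s].                             *)
Definition bd bs (a : nat) : L :=
  kos1 (bs a) - (if a is a'.+1 then kos0 (bs a') else 0).

(* With [y_i] of weight [i], [e_s] of weight [s + 1] and [z] of weight [1] the  *)
(* differential [bd] is homogeneous, so that the power series solutions found   *)
(* below are polynomials.                                                       *)
Definition wt m : nat := \sum_(i < d.+1) i * m i.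
Definition wtJ J : nat := \sum_(s < d | s \in J) s.+1.
Definition wlt W c := forall J m, m \in msupp (c J) -> (wt m + wtJ J < W)%N.

Lemma wtD m m' : wt (m + m') = (wt m + wt m')%N.
Proof. by rewrite /wt -big_split; apply: eq_bigr => i _; rewrite mnmDE mulnDr. Qed.

Lemma wt1 (i : 'I_d.+1) : wt U_(i) = i.
Proof.
rewrite /wt (bigD1 i) //= mnm1E eqxx muln1 big1 ?addn0 // => i' ii'.
by rewrite mnm1E eq_sym (negbTE ii') muln0.
Qed.

Lemma wltD W b c : wlt W b -> wlt W c -> wlt W (b + c).
Proof.
move=> hb hc J m; rewrite ffunE => /msuppD_le.
by rewrite mem_cat => /orP[/hb|/hc].
Qed.

Lemma wlt0 c : wlt 0 c -> c = 0.
Proof.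
move=> h; apply/ffunP=> J; rewrite ffunE; apply/mpolyP=> m; rewrite mcoeff0.
by apply: memN_msupp_eq0; apply/negP=> /h.
Qed.

(** The homotopy trades a factor y_(s+1) for e_s, both of weight s + 1. *)
Lemma wlt_khom W c : wlt W c -> wlt W (khom vhi c).
Proof.
move=> hc J m; rewrite ffunE => /msupp_sum_le /flattenP[ms /mapP[t]].
rewrite mem_filter => /andP[/andP[tJ _] _] ->.
rewrite mcoeff_msupp mcoeff_divvar; last exact: vhi_inj.
case: ifP; rewrite ?eqxx // -mcoeff_msupp => _ /hc; rewrite wtD wt1.
have -> : wtJ J = (t.+1 + wtJ (J :\ t))%N.
  by rewrite /wtJ (bigD1 t tJ); congr addn; apply: eq_bigl => s; rewrite in_setD1 andbC.
by rewrite addnA.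
Qed.

(** Here e_s of weight s + 1 becomes y_s of weight s; this drop makes the recursion of
    [strand_solve] terminate. *)
Lemma wlt_kos0 W c : wlt W.+1 c -> wlt W (kos0 c).
Proof.
move=> hc J m; rewrite kos0E => /msupp_kosv[s [m' [sJ /hc h ->]]].
by move: h; rewrite wtD wt1 /wtJ big_setU1 //=; set x := \sum_(i in J) _; lia.
Qed.

Lemma wlt_exists n cs : (forall a, (n < a)%N -> cs a = 0) ->
  exists W, forall a, wlt (W - a) (cs a).
Proof.
move=> cs0; pose B := \max_(a < n.+1) \max_J \max_(m <- msupp (cs a J)) (wt m + wtJ J)%N.
exists (B + n.+1)%N => a; have [na J m|an J m hm] := ltnP n a.
  by rewrite cs0 // ffunE msupp0.
suff : (wt m + wtJ J <= B)%N by lia.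
have aP : (a < n.+1)%N by [].
apply: leq_trans (leq_bigmax (Ordinal aP)); apply: leq_trans (leq_bigmax J).
by apply: (leq_bigmax_seq (F := fun m => wt m + wtJ J)%N).
Qed.

(** The lowest coefficient is [kos1 b]; subtracting the image of b under [bd] leaves a multiple of
    z, and the quotient by z is a problem of the same kind with weight bound smaller by one. [Z] is
    the invariant carried along: being a cycle in positive exterior degree, being killed by the
    evaluation in degree 0. *)
Lemma strand_solve j (Z : (nat -> L) -> Prop) :
  (forall cs, (forall a, exdeg j (cs a)) -> Z cs ->
     kos1 (cs 0%N) = 0 /\
     forall m, (forall s, m (vhi s) = 0%N) -> (cs 0%N set0)@_m = 0) ->
  (forall cs b, (forall a, exdeg j (cs a)) -> exdeg j.+1 b -> Z cs -> cs 0%N = kos1 b ->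
     Z (fun a => cs a.+1 + (if a is 0 then kos0 b else 0))) ->
  forall W cs, (forall a, exdeg j (cs a)) -> (forall a, wlt (W - a) (cs a)) -> Z cs ->
  exists bs, [/\ forall a, exdeg j.+1 (bs a), forall a, (W <= a)%N -> bs a = 0
    & cs =1 bd bs].
Proof.
move=> Z0 ZS; elim=> [|W IH] cs csj csW Zcs.
  exists (fun _ => 0); split=> // [a|a]; first exact: exdeg0.
  rewrite /bd; case: a => [|a]; rewrite !raddf0 addr0; apply: wlt0; exact: csW.
have [Z1 Zpure] := Z0 _ csj Zcs.
pose b := khom vhi (cs 0%N).
have bj : exdeg j.+1 b by apply: (exdeg_khom vhi_inj).
have cs0 : cs 0%N = kos1 b.
  rewrite -[LHS](koszul_homotopy vhi_inj Zpure).
  by rewrite -kos1E Z1 (khomz _ vhi_inj) addr0.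
have [|a|bs [bsj bsW csE]] := IH _ _ _ (ZS _ b csj bj Zcs cs0).
- by case=> [|a]; rewrite ?addr0 //; apply: exdegD => //; apply: exdeg_kos0.
- have := csW a.+1; rewrite subSS; case: a => [|a] h; rewrite ?addr0 //.
  rewrite subn0 in h *; apply: wltD => //; apply: wlt_kos0; apply: wlt_khom; exact: (csW 0%N).
exists (fun a => if a is a'.+1 then bs a' else b); split=> [[|a]|[|a]|] //.
  exact: bsW.
case=> [|a]; first by rewrite /bd subr0.
have := csE a; rewrite /bd; case: a => [|a]; rewrite ?addr0 // subr0 => <-.
by rewrite addrK.
Qed.

(** Above the z-degree of [cs], the top coefficient of the lift is a cycle for [kos0], hence
    [kos0 e]. Adding to the lift the image under [bd] of e times the next lower power of z removes
    that coefficient without changing the boundary. *)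
Lemma strand_trunc j n M cs bs N : (0 < M)%N -> (n <= M)%N ->
  (forall a, (n < a)%N -> cs a = 0) -> cs =1 bd bs ->
  (forall a, exdeg j.+1 (bs a)) -> (forall a, (N <= a)%N -> bs a = 0) ->
  exists bs', [/\ forall a, exdeg j.+1 (bs' a), forall a, (M <= a)%N -> bs' a = 0
    & cs =1 bd bs'].
Proof.
move=> M0 nM csn; elim: N bs => [|N IH] bs csE bsj bsN.
  by exists bs; split=> // a _; apply: bsN.
have [NM|MN] := ltnP N M.
  by exists bs; split=> // a Ma; apply: bsN; apply: leq_trans Ma.
have [e ej eE] : exists2 e, exdeg j.+2 e & bs N = kos0 e.
  apply: kos0_exact => //.
  have := csE N.+1; rewrite csn ?ltnS ?(leq_trans nM) // /bd bsN // raddf0 sub0r.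
  by move/eqP; rewrite eq_sym oppr_eq0 => /eqP.
have N0 := leq_trans M0 MN.
case: N N0 MN bsN IH eE => [//|N] _ MN bsN IH eE.
apply: (IH (fun a => if a == N then bs N + kos1 e else if a == N.+1 then 0 else bs a)).
- move=> a; rewrite csE /bd; case: (a =P N) => [->|/eqP aN].
    rewrite raddfD /= kos11 addr0; case: N {MN IH eE bsN} => // N.
    have -> : (N == N.+1) = false by lia.
    have -> : (N == N.+2) = false by lia.
    by [].
  case: a aN => [|a] aN; first by [].
  rewrite eqSS; case: (a =P N) => [->|/eqP aN'].
    by rewrite raddf0 sub0r eE raddfD /= kos01 opprB.
  case: (a =P N.+1) => [->|//].
  by rewrite eE kos00 !raddf0.
- move=> a; case: eqP => _; first by apply: exdegD => //; apply: exdeg_kos1.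
  by case: eqP => _ //; apply: exdeg0.
- move=> a Na; rewrite gtn_eqF //; case: eqP => // /eqP aN; apply: bsN.
  by rewrite ltn_neqAle eq_sym aN.
Qed.

End Strands.

(** * Non-negative powers, the quadratic map and negative powers *)

Section StrandExactness.
Variables (K : comNzRingType) (d : nat).
Local Notation R := {mpoly K[d.+1]}.
Local Notation L := {ffun {set 'I_d} -> R}.
Implicit Types (b c e : L) (bs cs hs gs : nat -> L) (j n : nat).

Lemma bdK bs a : bd (bd bs) a = 0.
Proof.
rewrite /bd; case: a => [|[|a]]; rewrite ?subr0 ?kos11 //.
  by rewrite raddfB /= kos11 sub0r kos01 opprK addNr.
by rewrite !raddfB /= kos11 kos00 kos01 sub0r !opprK addr0 addNr.
Qed.

Lemma strand_solve_cycle j cs n : (0 < j)%N -> (forall a, exdeg j (cs a)) ->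
  (forall a, (n < a)%N -> cs a = 0) -> (forall a, bd cs a = 0) ->
  exists N bs, [/\ forall a, exdeg j.+1 (bs a), forall a, (N <= a)%N -> bs a = 0
    & cs =1 bd bs].
Proof.
move=> j0 csj csn csZ; have [W csW] := wlt_exists csn.
have [||bs hbs] := @strand_solve _ _ j (fun cs => forall a, bd cs a = 0) _ _ W cs csj csW csZ.
- move=> cs' csj' csZ'; split=> [|m _]; first by have := csZ' 0%N; rewrite /bd subr0.
  by rewrite csj' ?mcoeff0 // cards0 neq_ltn j0.
- move=> cs' b csj' bj csZ' cs0 [|a]; rewrite /bd /=.
    by rewrite subr0 raddfD /= -[kos1 (kos0 b)]opprK -kos01 -cs0; exact: (csZ' 1%N).
  rewrite addr0; apply: etrans (csZ' a.+2); rewrite /bd; congr (_ - _).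
  by case: a => [|a]; rewrite ?addr0 //= raddfD /= kos00 addr0.
by exists W, bs.
Qed.

Lemma strand_exact j n cs : (0 < j)%N -> (forall a, exdeg j (cs a)) ->
  (forall a, (n.+1 < a)%N -> cs a = 0) -> (forall a, bd cs a = 0) ->
  exists bs, [/\ forall a, exdeg j.+1 (bs a), forall a, (n < a)%N -> bs a = 0
    & cs =1 bd bs].
Proof.
move=> j0 csj csn csZ; have [N [bs [bsj bsN csE]]] := strand_solve_cycle j0 csj csn csZ.
exact: (strand_trunc (ltn0Sn n) (leqnn _) csn csE bsj bsN).
Qed.

(* In the column [z^0] the lift [bs 0] is itself a cycle for [kos0], whence the *)
(* quadratic map of the resolution.                                            *)
Lemma strand0_lift j cs : (exists N bs, [/\ forall a, exdeg j.+1 (bs a),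
    forall a, (N <= a)%N -> bs a = 0 & cs =1 bd bs]) ->
  (forall a, (0 < a)%N -> cs a = 0) ->
  exists2 e, exdeg j.+2 e & cs 0%N = kos1 (kos0 e).
Proof.
move=> [N [bs [bsj bsN csE]]] csn.
have [|bs' [bsj' bs0 {}csE]] := strand_trunc (ltn0Sn 0) _ csn csE bsj bsN => //.
have [|e ej eE] := kos0_exact (bsj' 0%N); last first.
  by exists e => //; rewrite csE /bd subr0 eE.
have := csE 1%N; rewrite csn // /bd (bs0 1%N) // raddf0 sub0r => /eqP.
by rewrite eq_sym oppr_eq0 => /eqP.
Qed.

(** Such a c, taken as a constant in z, is a cycle for [bd]. *)
Lemma strand0_exact j c : (0 < j)%N -> exdeg j c -> kos0 c = 0 -> kos1 c = 0 ->
  exists2 e, exdeg j.+2 e & c = kos1 (kos0 e).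
Proof.
move=> j0 cj c0 c1; pose cs a : L := if a is 0 then c else 0.
have csn a : (0 < a)%N -> cs a = 0 by case: a.
apply: (@strand0_lift j cs) => //; apply: (@strand_solve_cycle j cs 0) => //.
  by case=> [|a] //=; apply: exdeg0.
by case=> [|[|a]]; rewrite /bd /cs ?c1 ?c0 ?raddf0 ?addr0.
Qed.

(** With [hs a] the coefficient of z^(-1-a), the lift is built from a = 0 on. The start uses
    [strand0_exact]: if [kos0 (hs 0)] is [kos1 (kos0 e)], then [hs 0 + kos1 e] is a cycle for [kos0]
    by anticommutation. Each further coefficient needs [kos0_exact] once. *)
Lemma dual_strand_exact j l hs : (0 < j)%N -> (forall a, exdeg j.+1 (hs a)) ->
  (forall a, (a < l)%N -> kos1 (hs a) = kos0 (hs a.+1)) ->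
  kos1 (kos0 (hs 0%N)) = 0 ->
  exists gs, (forall a, exdeg j.+2 (gs a)) /\
    (forall a, (a <= l)%N -> hs a = kos1 (gs a) - kos0 (gs a.+1)).
Proof.
move=> j0 hsj; elim: l => [|l IH] hsZ h0.
  have [e ej eE] := strand0_exact j0 (exdeg_kos0 (hsj 0%N)) (kos00 _) h0.
  have [||e' ej' eE'] := @kos0_exact _ _ j (hs 0%N + kos1 e).
  - by apply: exdegD => //; apply: exdeg_kos1.
  - by rewrite raddfD /= kos01 eE subrr.
  exists (fun a => if a is 0 then - e else - e'); split=> [[|a]|]; try exact: exdegN.
  by move=> [|a] // _; rewrite !raddfN opprK /= -eE' addrC addrK.
have [|gs [gsj gsE]] := IH _ h0; first by move=> a al; apply: hsZ; apply: leqW.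
pose x := hs l.+1 - kos1 (gs l.+1).
have xj : exdeg j.+1 x by apply: exdegD => //; apply/exdegN/exdeg_kos1.
have [||e ej eE] := @kos0_exact _ _ j x => //.
  rewrite raddfB /= -hsZ // [in kos1 (hs l)]gsE // raddfB /= kos11 kos01.
  by rewrite sub0r opprK addNr.
exists (fun a => if a == l.+2 then - e else gs a); split=> [a|a].
  by case: eqP => _ //; apply: exdegN.
rewrite leq_eqVlt => /predU1P[->|al]; last first.
  have -> : (a == l.+2) = false by lia.
  have -> : (a.+1 == l.+2) = false by lia.
  exact: gsE.
have -> : (l.+1 == l.+2) = false by lia.
by rewrite eqxx [kos0 (- e)]raddfN opprK /= -eE subrKC.
Qed.

End StrandExactness.

(** * Evaluation at the Veronese monomials *)

Section Augmentation.
Variables (K : fieldType) (d : nat).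
Local Notation R := {mpoly K[d.+1]}.
Local Notation L := {ffun {set 'I_d} -> R}.
Local Notation vm := (veronese_monomials K d).
Local Notation x1 := ('X_ord0 : {mpoly K[2]}).
Local Notation x2 := ('X_ord_max : {mpoly K[2]}).
Implicit Types (b c e : L) (bs cs : nat -> L) (n N : nat).

(** The value at z = x_1 / x_2, cleared of denominators by x_2^N; only exterior degree 0
    contributes. *)
Definition ev N cs : {mpoly K[2]} :=
  \sum_(a < N.+1) (cs a set0 \mPo vm) * (x1 ^+ a * x2 ^+ (N - a)).

Lemma ev_widen N cs : cs N.+1 = 0 -> ev N.+1 cs = x2 * ev N cs.
Proof.
move=> csN; rewrite /ev big_ord_recr /= csN ffunE comp_mpoly0 mul0r addr0 mulr_sumr.
apply: eq_bigr => a _; rewrite subSn ?exprS; last by have := ltn_ord a; lia.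
ring.
Qed.

Lemma mpolyX_neq0 (i : 'I_2) : ('X_i : {mpoly K[2]}) != 0.
Proof. by rewrite -msupp_eq0 msuppX. Qed.

Lemma ev_shift N cs (p : R) : cs 0%N set0 \mPo vm = p \mPo vm ->
  ev N.+1 cs = (p \mPo vm) * x2 ^+ N.+1 + x1 * ev N (fun a => cs a.+1).
Proof.
move=> csp; rewrite /ev big_ord_recl /= csp subn0 mul1r mulr_sumr; congr (_ + _).
by apply: eq_bigr => a _; rewrite /bump /= add1n subSS exprS; ring.
Qed.

Lemma comp_vmX (i : 'I_d.+1) : 'X_i \mPo vm = x1 ^+ i * x2 ^+ (d - i).
Proof. by rewrite comp_mpolyXU -tnth_nth tnth_mktuple. Qed.

(** This is the vanishing of the f_s: x_2 times the image of y_(s+1) is x_1 times the image of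
    y_s. *)
Lemma comp_kos0_kos1 b :
  x2 * (kos1 b set0 \mPo vm) = x1 * (kos0 b set0 \mPo vm).
Proof.
rewrite kos0E kos1E !ffunE !rmorph_sum !mulr_sumr; apply: eq_bigr => s _.
rewrite !rmorphM /= /ksgn !rmorph_sign !comp_vmX /= /bump /= add1n.
rewrite exprS -[(d - s)%N in RHS]prednK ?subn_gt0 ?ltn_ord // exprS -subnS.
by ring.
Qed.

Lemma ev_bd N bs : bs N = 0 -> ev N (bd bs) = 0.
Proof.
move=> bsN; rewrite /ev /bd.
under eq_bigr do rewrite !ffunE raddfB /= mulrBl.
rewrite sumrB big_ord_recr /= bsN raddf0 ffunE comp_mpoly0 mul0r addr0.
rewrite big_ord_recl /= ffunE comp_mpoly0 mul0r add0r -sumrB big1 // => a _.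
rewrite /bump /= add1n (_ : (N - a = (N - a.+1).+1)%N); last by have := ltn_ord a; lia.
apply/eqP; rewrite subr_eq0; apply/eqP; rewrite !exprS.
have := comp_kos0_kos1 (bs a); set p := _ \mPo _; set q := _ \mPo _ => h.
transitivity (x2 * p * (x1 ^+ a * x2 ^+ (N - a.+1))); first by ring.
by rewrite h; ring.
Qed.

Lemma comp_kos1_kos0 e : kos1 (kos0 e) set0 \mPo vm = 0.
Proof.
have := comp_kos0_kos1 (kos0 e); rewrite kos00 ffunE comp_mpoly0 mulr0 => /eqP.
by rewrite mulf_eq0 (negbTE (mpolyX_neq0 _)) => /eqP.
Qed.

Lemma comp_vmXm (m : 'X_{1..d.+1}) :
  'X_[m] \mPo vm = x1 ^+ wt m * x2 ^+ (\sum_(i < d.+1) (d - i) * m i).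
Proof.
rewrite comp_mpolyX /wt -!prodrXr -big_split; apply: eq_bigr => i _ /=.
by rewrite tnth_mktuple exprMn !exprM.
Qed.

Lemma mcoeff_x1x2 a a' N N' :
  (x1 ^+ a * x2 ^+ N)@_(U_(ord0) *+ a' + U_(ord_max) *+ N') =
  ((a == a') && (N == N'))%:R.
Proof.
rewrite !mpolyXn -mpolyXD mcoeffX; congr (_%:R); congr nat_of_bool.
apply/eqP/andP => [/mnmP h|[/eqP -> /eqP -> //]].
have := h ord0; have := h ord_max; rewrite !mnmDE !mulmnE !mnm1E /=.
by rewrite !mul0n !mul1n !addn0 !add0n => -> ->.
Qed.

Hypothesis d0 : (0 < d)%N.

(** Weight 0 singles out the powers of y_0, the only monomials sent to powers of x_2, and for d > 0
    they have distinct images. This lets the evaluation detect the monomials excluded in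
    [koszul_homotopy]. *)
Lemma mcoeff_comp_vm_pure N (p : R) (m : 'X_{1..d.+1}) : wt m = 0%N ->
  ((p \mPo vm) * x2 ^+ N)@_(U_(ord_max) *+ (d * mdeg m + N)) = p@_m.
Proof.
have pureE (m' : 'X_{1..d.+1}) : wt m' = 0%N -> (\sum_(i < d.+1) (d - i) * m' i)%N = (d * mdeg m')%N.
  move=> h; rewrite mdegE big_distrr -[LHS]add0n -[X in (X + _)%N]h /wt -big_split.
  by apply: eq_bigr => i _; rewrite /= -mulnDl subnKC // -ltnS.
have pure0 (m' : 'X_{1..d.+1}) : wt m' = 0%N -> m' = (U_(ord0) *+ mdeg m')%MM.
  move/eqP; rewrite sum_nat_eq0 => /forall_inP h; apply/mnmP=> i.
  have h' (i' : 'I_d.+1) : i' != ord0 -> m' i' = 0%N.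
    by move=> i0; have := h i' isT; rewrite muln_eq0 -[X in X || _]/(i' == ord0) (negbTE i0) => /eqP.
  rewrite mulmnE mnm1E mdegE; case: eqP => [<-|/eqP i0]; last first.
    by rewrite mul0n h' // eq_sym.
  by rewrite (bigD1 ord0) //= mul1n big1 ?addn0 // => i' /h'.
move=> m0; rewrite comp_mpolyEX mulr_suml raddf_sum /=.
transitivity (\sum_(m' <- msupp p) (p@_m' *: 'X_[m'])@_m); last first.
  by rewrite -raddf_sum -mpolyE.
apply: eq_bigr => m' _; rewrite -scalerAl !mcoeffZ comp_vmXm; congr (_ * _).
rewrite -mulrA -exprD -[X in _@_X]add0m -[X in (X + _)%MM](mulm0n U_(ord0)%MM).
rewrite mcoeff_x1x2 mcoeffX; congr (_%:R); congr nat_of_bool.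
apply/andP/eqP => [[/eqP w0]|->]; last by rewrite m0 pureE // !eqxx.
rewrite pureE // eqn_add2r eqn_pmul2l // => /eqP E.
by rewrite (pure0 _ w0) (pure0 _ m0) E.
Qed.

Lemma strand_solve_ev cs n : (forall a, exdeg 0 (cs a)) ->
  (forall a, (n < a)%N -> cs a = 0) -> ev n cs = 0 ->
  exists N bs, [/\ forall a, exdeg 1 (bs a), forall a, (N <= a)%N -> bs a = 0
    & cs =1 bd bs].
Proof.
move=> csj csn csZ; have [W csW] := wlt_exists csn.
have [|||bs hbs] := @strand_solve _ _ 0 (fun cs => exists N,
    (forall a, (N < a)%N -> cs a = 0) /\ ev N cs = 0) _ _ W cs csj csW.
- move=> {n csn csj csZ csW} cs' csj [n [csn csZ]]; split=> [|m mhi].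
    rewrite kos1E; apply/ffunP=> J; rewrite !ffunE big1 // => s sJ.
    by rewrite csj ?mulr0 // cardsU1 sJ.
  have m0 : wt m = 0%N.
    apply/eqP; rewrite sum_nat_eq0; apply/forallP=> i; apply/implyP=> _.
    by case: (unliftP ord0 i) => [s ->|->]; rewrite ?mhi ?muln0.
  rewrite -(mcoeff_comp_vm_pure n _ m0) -[RHS](@mcoeff0 2 K (U_(ord_max) *+ (d * mdeg m + n))%MM).
  rewrite -csZ /ev big_ord_recl subn0 expr0 mul1r mcoeffD /=.
  (* The remaining terms have a factor x_1, hence no pure power of x_2. *)
  rewrite raddf_sum big1 ?addr0 // => a _ /=.
  rewrite /bump /= add1n exprS -mulrA mulrCA mcoeffXM mulmnE mnm1E.
  by rewrite mul0n.
- move=> {n csn csj csZ csW} cs' b csj bj [n [csn csZ]] cs0; exists n; split.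
    by move=> [|a] // an; rewrite csn ?addr0 // ltnW.
  (* x_1 times the new evaluation is x_2 times the old one, so it vanishes and x_1 can be
     cancelled. *)
  apply: (mulfI (mpolyX_neq0 ord0)); rewrite mulr0.
  have evD : ev n (fun a => cs' a.+1 + (if a is 0 then kos0 b else 0)) =
      ev n (fun a => cs' a.+1) + (kos0 b set0 \mPo vm) * x2 ^+ n.
    rewrite /ev; under eq_bigr do rewrite ffunE raddfD /= mulrDl.
    rewrite big_split /=; congr (_ + _); rewrite big_ord_recl /= subn0 mul1r.
    by rewrite big1 ?addr0 // => a _; rewrite /= ffunE comp_mpoly0 mul0r.
  have := csZ; move/(congr1 (fun p => x2 * p)); rewrite -ev_widen ?csn // mulr0.
  rewrite (@ev_shift _ _ (kos1 b set0)) ?cs0 // => csZ'.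
  rewrite evD -[RHS]csZ' mulrDr addrC; congr (_ + _).
  by rewrite [LHS]mulrA -comp_kos0_kos1 exprS; ring.
- by exists n.
by exists W, bs.
Qed.

End Augmentation.

(** * The resolution of the Veronese module *)

Section VeroneseStrands.
Variables (K : fieldType) (d k : nat).
Local Notation R := {mpoly K[d.+1]}.
Local Notation L := {ffun {set 'I_d} -> R}.
Implicit Types (b c e : L) (bs cs : nat -> L) (i a : nat).

(* The i-th free module of the resolution is spanned by the [z^a e_J] with      *)
(* [#|J| = ext_deg i] and [a < num_pow i]; for [k < i] the index [a] stands for *)
(* the negative power [z^(-1-a)].                                              *)
Definition num_pow i : nat := (if i <= k then k.+1 - i else i - k)%N.
Definition ext_deg i : nat := if (i <= k)%N then i else i.+1.

(** The map from position i + 1 to position i. For negative powers both ends are cut off: [kos0] out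
    of z^(-1) and [kos1] out of the lowest power are dropped, as when x_1 and x_2 act on the inverse
    monomials x_1^(-1-a) x_2^(-1-b). *)
Definition vdiff i cs (a : nat) : L :=
  if (i < k)%N then bd cs a
  else if i == k then (if a is 0 then kos1 (kos0 (cs 0%N)) else 0)
  else if (a < num_pow i)%N then kos1 (cs a) - kos0 (cs a.+1) else 0.

Definition supported i cs :=
  (forall a, exdeg (ext_deg i) (cs a)) /\ (forall a, (num_pow i <= a)%N -> cs a = 0).

Lemma vdiff_ext i cs cs' : cs =1 cs' -> vdiff i cs =1 vdiff i cs'.
Proof. by move=> E [|a]; rewrite /vdiff /bd !E. Qed.

Lemma vdiff_supported i cs : supported i.+1 cs -> supported i (vdiff i cs).
Proof.
rewrite /supported /vdiff /num_pow /ext_deg => -[csj cs0].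
case: (ltngtP i k) csj cs0 => [ik|ki|ik] csj cs0.
- split=> [[|a]|a]; rewrite /bd.
  + by rewrite subr0; apply: exdeg_kos1.
  + by apply: exdegD; [apply: exdeg_kos1|apply/exdegN/exdeg_kos0].
  + case: a => [|a] ka; first by lia.
    by rewrite !cs0 ?raddf0 ?addr0 //; lia.
- split=> a; last by rewrite ltnNge => ->.
  case: ifP => _; last exact: exdeg0.
  by apply: exdegD; [apply: exdeg_kos1|apply/exdegN/exdeg_kos0].
- split=> [[|a]|[|a]] //; [|exact: exdeg0|by rewrite ik; lia].
  by apply/exdeg_kos1/exdeg_kos0.
Qed.

Lemma vdiffK i cs : vdiff i (vdiff i.+1 cs) =1 fun=> 0.
Proof.
move=> a; rewrite /vdiff /num_pow.
case: (ltngtP i k) => [ik|ki|ik]; case: (ltngtP i.+1 k) => [ik'|ki'|ik']; try lia.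
- exact: bdK.
- by rewrite /bd; case: a => [|[|a]]; rewrite ?subr0 ?kos11 ?kos01 ?kos00 ?raddf0 ?oppr0 ?addr0.
- case: ifP => // h1.
  have -> : (a < i.+1 - k)%N by lia.
  have -> : (a.+1 < i.+1 - k)%N by lia.
  by rewrite !raddfB /= kos11 kos00 kos01 sub0r !opprK addr0 addNr.
- case: a => [|a] //; rewrite ifT; last by lia.
  by rewrite raddfB /= kos00 subr0 kos01 raddfN /= kos11 oppr0.
Qed.

Lemma vdiff_exact i cs : supported i.+1 cs -> vdiff i cs =1 (fun=> 0) ->
  exists2 bs, supported i.+2 bs & cs =1 vdiff i.+1 bs.
Proof.
rewrite /supported /vdiff /num_pow /ext_deg.
case: (ltnP i k) => [ik|ki].
  case: (ltngtP i.+1 k) => [ik'|ki|ik'] [csj csn] csZ; first 1 last.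
  - by move: ik; rewrite ltnNge -ltnS ki.
  - have csn' a : (0 < a)%N -> cs a = 0 by move=> a0; apply: csn; lia.
    have [e ej eE] := strand0_lift (strand_solve_cycle (isT : 0 < i.+1)%N csj csn' csZ) csn'.
    exists (fun a => if a is 0 then e else 0).
      by split=> [[|a]|[|a]] //; [exact: exdeg0|lia].
    by move=> [|a] //; rewrite csn'.
  have [|bs [bsj bsn csE]] := @strand_exact _ _ i.+1 (k - i - 2) cs isT csj _ csZ.
    by move=> a ha; apply: csn; lia.
  exists bs => //; split=> // a ha; apply: bsn; lia.
have -> : (i.+1 < k)%N = false by lia.
have -> : (i.+1 == k) = false by lia.
move=> [csj csn] csZ.
have [a al|| gs [gsj gsE]] := @dual_strand_exact _ _ i.+1 (i - k) cs isT csj.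
- have := csZ a; case: eqP => [ik|_]; first by lia.
  rewrite (_ : (i <= k)%N = false); last by lia.
  by rewrite al => /eqP; rewrite subr_eq0 => /eqP.
(* At i = k this is the cycle condition for the quadratic map; for i > k it follows by applying
   [kos0] to [kos1 (cs 0) = kos0 (cs 1)]. *)
- move: (csZ 0%N); case: eqP => [_ //|ik].
  rewrite (_ : (i <= k)%N = false) ?ifT; [|lia|lia].
  by move/eqP; rewrite subr_eq0 => /eqP h; apply: oppr_inj; rewrite -kos01 h kos00 oppr0.
exists (fun a => if (a < i.+2 - k)%N then gs a else 0).
  split=> a; last by move=> ha; rewrite ifF //; lia.
  by case: ifP => _ //; apply: exdeg0.
move=> a; case: ifP => ha; last by rewrite csn //; lia.
by rewrite gsE ?ifT //; lia.
Qed.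

Lemma ev_vdiff0 cs : supported 1 cs -> ev k (vdiff 0 cs) = 0.
Proof.
rewrite /supported /vdiff /num_pow /ext_deg => -[csj csn].
case: (posnP k) csj csn => [k0|k0] csj csn.
  by rewrite k0 eqxx /ev big_ord_recl big_ord0 addr0 comp_kos1_kos0 mul0r.
by apply: ev_bd; apply: csn; lia.
Qed.

Lemma ev_exact cs (d0 : (0 < d)%N) : supported 0 cs -> ev k cs = 0 ->
  exists2 bs, supported 1 bs & cs =1 vdiff 0 bs.
Proof.
rewrite /supported /vdiff /num_pow /ext_deg => -[csj csn] csZ.
have {}csn a : (k < a)%N -> cs a = 0 by move=> ha; apply: csn.
have sol := strand_solve_ev d0 csj csn csZ.
case: (posnP k) csn => [k0|k0] csn.
  rewrite k0 in csn; have [e ej eE] := strand0_lift sol csn.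
  exists (fun a => if a is 0 then e else 0).
    by rewrite k0; split=> [[|a]|[|a]] //; exact: exdeg0.
  by move=> [|a]; rewrite k0 //; apply: csn.
have [N [bs [bsj bsN csE]]] := sol.
have [bs' [bsj' bsk {}csE]] := strand_trunc k0 (leqnn k) csn csE bsj bsN.
by exists bs' => //; split=> // a ha; apply: bsk; lia.
Qed.

End VeroneseStrands.

(** * The strands as matrices *)

Section VeroneseComplex.
Variables (K : fieldType) (d k : nat).
Local Notation R := {mpoly K[d.+1]}.
Local Notation L := {ffun {set 'I_d} -> R}.
Local Notation vm := (veronese_monomials K d).
Implicit Types (cs : nat -> L) (i : nat).

Definition vbasis i : {set 'I_(num_pow k i) * {set 'I_d}} :=
  [set p : 'I_(num_pow k i) * {set 'I_d} | #|p.2| == ext_deg k i].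
Definition vrank i : nat := #|vbasis i|.
Definition vpow i (p : 'I_(vrank i)) : nat := (enum_val p).1.
Definition vset i (p : 'I_(vrank i)) : {set 'I_d} := (enum_val p).2.

Lemma vrankE i : vrank i = (num_pow k i * 'C(d, ext_deg k i))%N.
Proof.
rewrite /vrank; have -> : vbasis i = setX setT [set J : {set 'I_d} | #|J| == ext_deg k i].
  by apply/setP=> -[a J]; rewrite !inE.
by rewrite cardsX cardsT card_ord card_draws card_ord.
Qed.

Definition fam i (v : 'rV[R]_(vrank i)) (a : nat) : L :=
  [ffun J => \sum_p v 0 p *+ ((vpow p == a) && (vset p == J))].
Definition unfam i cs : 'rV[R]_(vrank i) := \row_p cs (vpow p) (vset p).

Lemma vbasis_inj i (p q : 'I_(vrank i)) :
  vpow p = vpow q -> vset p = vset q -> p = q.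
Proof.
rewrite /vpow /vset => h1 h2; apply: enum_val_inj; move: h1 h2.
by case: (enum_val p) (enum_val q) => [a J] [a' J'] /= /val_inj -> ->.
Qed.

Lemma famK i (v : 'rV[R]_(vrank i)) : unfam i (fam v) = v.
Proof.
apply/rowP=> p; rewrite mxE ffunE (bigD1 p) //= !eqxx big1 ?addr0 // => q qp.
case: andP => // -[/eqP h1 /eqP h2]; case/eqP: qp; exact: vbasis_inj.
Qed.

Lemma fam_supported i (v : 'rV[R]_(vrank i)) : supported k i (fam v).
Proof.
split=> [a J hJ|a ha].
  rewrite ffunE big1 // => p _; case: andP => // -[_ /eqP pJ].
  by have := enum_valP p; rewrite inE -/(vset p) pJ (negbTE hJ).
apply/ffunP=> J; rewrite !ffunE big1 // => p _; case: andP => // -[/eqP pa _].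
by move: ha; rewrite leqNgt -pa ltn_ord.
Qed.

Lemma unfamK i cs : supported k i cs -> fam (unfam i cs) =1 cs.
Proof.
move=> [csj csn] a; have [ha|ha] := ltnP a (num_pow k i); last first.
  by rewrite csn // (fam_supported _).2.
apply/ffunP=> J; have [hJ|hJ] := eqVneq #|J| (ext_deg k i); last first.
  by rewrite csj // (fam_supported _).1.
have pP : (Ordinal ha, J) \in vbasis i by rewrite inE /= hJ.
have pa : vpow (enum_rank_in pP (Ordinal ha, J)) = a by rewrite /vpow enum_rankK_in.
have pJ : vset (enum_rank_in pP (Ordinal ha, J)) = J by rewrite /vset enum_rankK_in.
rewrite ffunE (bigD1 (enum_rank_in pP (Ordinal ha, J))) //= mxE pa pJ !eqxx.
rewrite big1 ?addr0 // => q qp; case: andP => // -[/eqP h1 /eqP h2].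
by case/eqP: qp; apply: vbasis_inj; rewrite ?pa ?pJ.
Qed.

Definition scl (r : R) (c : L) : L := [ffun J => r * c J].

Lemma scl_kos0 r c : kos0 (scl r c) = scl r (kos0 c).
Proof. by rewrite kos0E; apply: kosZ. Qed.

Lemma scl_kos1 r c : kos1 (scl r c) = scl r (kos1 c).
Proof. by rewrite kos1E; apply: kosZ. Qed.

Lemma sclB r b c : scl r (b - c) = scl r b - scl r c.
Proof. by apply/ffunP=> J; rewrite !ffunE mulrBr. Qed.

Lemma scl0 r : scl r 0 = 0.
Proof. by apply/ffunP=> J; rewrite !ffunE mulr0. Qed.

Lemma vdiff_linear i r cs cs' a :
  vdiff k i (fun a => scl r (cs a) + cs' a) a = scl r (vdiff k i cs a) + vdiff k i cs' a.
Proof.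
rewrite /vdiff /bd; case: ifP => _; last case: ifP => _.
- case: a => [|a]; first by rewrite !subr0 raddfD /= scl_kos1.
  by rewrite !raddfD /= scl_kos1 scl_kos0 sclB addrACA.
- by case: a => [|a]; rewrite ?scl0 ?addr0 // !raddfD /= scl_kos0 scl_kos1.
case: ifP => _; last by rewrite scl0 addr0.
by rewrite !raddfD /= scl_kos1 scl_kos0 sclB addrACA.
Qed.

Definition vmap i (v : 'rV[R]_(vrank i.+1)) : 'rV[R]_(vrank i) :=
  unfam i (vdiff k i (fam v)).

Lemma vmap_is_linear i : linear (@vmap i).
Proof.
move=> r u v; apply/rowP=> p; rewrite !mxE.
have -> : vdiff k i (fam (r *: u + v)) (vpow p) =
    vdiff k i (fun a => scl r (fam u a) + fam v a) (vpow p).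
  apply: vdiff_ext => a; apply/ffunP=> J; rewrite !ffunE mulr_sumr -big_split.
  by apply: eq_bigr => q _; rewrite !mxE mulrnDl mulrnAr.
by rewrite vdiff_linear !ffunE.
Qed.

HB.instance Definition _ i :=
  GRing.isLinear.Build R 'rV[R]_(vrank i.+1) 'rV[R]_(vrank i) _ (@vmap i)
    (@vmap_is_linear i).

(** This is [k + ext_deg k i * d]: every e_s counts d and z counts 0. *)
Definition vdeg i : nat := if (i <= k)%N then (k + i * d)%N else (k + i.+1 * d)%N.

Definition veronese_complex : free_complex K d :=
  FreeComplex (fun i (_ : 'I_(vrank i)) => vdeg i) (fun i => lin1_mx (@vmap i)).
Local Notation F := veronese_complex.

Lemma mul_vdiff i (v : 'rV[R]_(vrank i.+1)) : v *m fc_diff F i = vmap v.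
Proof. exact: mul_rV_lin1. Qed.

Lemma vmap_eq0 i (v : 'rV[R]_(vrank i.+1)) :
  vmap v = 0 <-> vdiff k i (fam v) =1 fun=> 0.
Proof.
split=> h; last by apply/rowP=> p; rewrite !mxE h ffunE.
have sup := vdiff_supported (fam_supported v).
move=> a; rewrite -(unfamK sup) -/(vmap v) h; apply/ffunP=> J.
by rewrite !ffunE big1 // => p _; rewrite mxE mul0rn.
Qed.

Lemma unfam_ext i cs cs' : cs =1 cs' -> unfam i cs = unfam i cs'.
Proof. by move=> E; apply/rowP=> p; rewrite !mxE E. Qed.

Lemma vcomplex_exact i (v : 'rV[R]_(vrank i.+1)) :
  v *m fc_diff F i = 0 <-> exists w, v = w *m fc_diff F i.+1.
Proof.
rewrite mul_vdiff; split=> [/vmap_eq0 h|[w ->]].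
  have [bs bss bsE] := vdiff_exact (fam_supported v) h.
  exists (unfam _ bs); rewrite mul_vdiff -[LHS]famK; apply: unfam_ext => a.
  by rewrite bsE; apply/esym/vdiff_ext/unfamK.
rewrite mul_vdiff; apply/vmap_eq0 => a.
rewrite -(vdiffK k i (fam w) a); apply: vdiff_ext; apply: unfamK.
exact: (vdiff_supported (fam_supported w)).
Qed.

End VeroneseComplex.

(** * Grading, augmentation and minimality *)

Section VeroneseResolution.
Variables (K : fieldType) (d k : nat).
Hypothesis d0 : (0 < d)%N.
Local Notation R := {mpoly K[d.+1]}.
Local Notation L := {ffun {set 'I_d} -> R}.
Local Notation vm := (veronese_monomials K d).
Local Notation F := (veronese_complex K d k).
Local Notation x1 := ('X_ord0 : {mpoly K[2]}).
Local Notation x2 := ('X_ord_max : {mpoly K[2]}).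

Definition coef_homog e (c : L) := forall J m, m \in msupp (c J) -> mdeg m = e.

Lemma coef_homogB e (b c : L) :
  coef_homog e b -> coef_homog e c -> coef_homog e (b - c).
Proof.
move=> hb hc J m; rewrite !ffunE => /msuppB_le.
by rewrite mem_cat => /orP[/hb|/hc].
Qed.

Lemma coef_homog0 e : coef_homog e 0.
Proof. by move=> J m; rewrite ffunE msupp0. Qed.

Lemma coef_homog_kos e (v : 'I_d -> 'I_d.+1) (c : L) :
  coef_homog e c -> coef_homog e.+1 (kos (fun s => 'X_(v s)) c).
Proof.
move=> hc J m /msupp_kosv[s [m' [_ /hc <- ->]]].
by rewrite mdegD mdeg1.
Qed.

Lemma coef_homog_kos0 e (c : L) : coef_homog e c -> coef_homog e.+1 (kos0 c).
Proof. by rewrite kos0E; apply: coef_homog_kos. Qed.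

Lemma coef_homog_kos1 e (c : L) : coef_homog e c -> coef_homog e.+1 (kos1 c).
Proof. by rewrite kos1E; apply: coef_homog_kos. Qed.

Lemma coef_homog_vdiff i e (cs : nat -> L) a : (forall a, coef_homog e (cs a)) ->
  coef_homog ((i == k).+1 + e) (vdiff k i cs a).
Proof.
move=> hc; rewrite /vdiff /bd; case: (i =P k) => [->|_]; rewrite ?ltnn.
  case: a => [|a]; last exact: coef_homog0.
  exact/coef_homog_kos1/coef_homog_kos0.
case: ifP => _; last case: ifP => _; last exact: coef_homog0.
  case: a => [|a]; first by rewrite subr0; apply: coef_homog_kos1.
  by apply: coef_homogB; [apply: coef_homog_kos1|apply: coef_homog_kos0].
by apply: coef_homogB; [apply: coef_homog_kos1|apply: coef_homog_kos0].
Qed.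

(** Entries are linear forms, and quadratic ones where the two parts meet; both the grading and
    minimality follow from this. *)
Lemma fc_diff_mdeg i p q m : m \in msupp (fc_diff F i p q) -> mdeg m = (i == k).+1.
Proof.
rewrite mxE mxE -[RHS]addn0; apply: coef_homog_vdiff => a J {}m.
rewrite ffunE => /msupp_sum_le /flattenP[ms /mapP[r _ ->]].
rewrite mxE -mulrnA mulnb; case: (_ && _) => /=; last by rewrite mulr0n msupp0.
by rewrite mulr1n msupp1 inE => /eqP ->; rewrite mdeg0.
Qed.

Lemma vdegS i : vdeg d k i.+1 = (vdeg d k i + d * (i == k).+1)%N.
Proof.
by rewrite /vdeg; case: (ltngtP i k) => h; nia.
Qed.

Lemma homog_veronese (p : {mpoly K[2]}) : p \is k.-homog ->
  (p : S_over_R K d) \in veronese_pred k.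
Proof. by move=> /dhomogP h; apply/allP=> m /h ->; rewrite leqnn subnn dvdn0. Qed.

Lemma monomial_homog a b : (x1 ^+ a * x2 ^+ b) \is (a + b).-homog.
Proof. by rewrite !mpolyXn -mpolyXD dhomogX /= mdegD !mdegMn !mdeg1 !mul1n. Qed.

Lemma vpow_le (p : 'I_(vrank d k 0)) : (vpow p <= k)%N.
Proof. exact: ltn_ord (enum_val p).1. Qed.

Lemma vgen_homog (p : 'I_(vrank d k 0)) :
  (x1 ^+ vpow p * x2 ^+ (k - vpow p)) \is k.-homog.
Proof. by have := monomial_homog (vpow p) (k - vpow p); rewrite subnKC // vpow_le. Qed.

Definition vgen (p : 'I_(vrank d k 0)) : veronese K d k :=
  Veronese (homog_veronese (vgen_homog p)).

Lemma veronese_valZ (r : R) (x : veronese_type K d k) :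
  veronese_val (r *: x) = (r \mPo vm) * (veronese_val x : {mpoly K[2]}) :> {mpoly K[2]}.
Proof. by []. Qed.

Lemma veronese_valD (x y : veronese_type K d k) :
  veronese_val (x + y) = veronese_val x + veronese_val y.
Proof. by []. Qed.

Lemma val_augmentation (v : 'rV[R]_(vrank d k 0)) :
  veronese_val (augmentation (F := F) vgen v : veronese_type K d k) = ev k (fam v).
Proof.
rewrite /augmentation raddf_sum /ev.
transitivity (\sum_(a < k.+1) \sum_p (if vpow p == a then
    (v 0 p \mPo vm) * (x1 ^+ vpow p * x2 ^+ (k - vpow p)) else 0)); last first.
  apply: eq_bigr => a _; rewrite ffunE rmorph_sum mulr_suml; apply: eq_bigr => p _.
  have /eqP -> : vset p == set0.
    by have := enum_valP p; rewrite inE /ext_deg leq0n cards_eq0.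
  rewrite eqxx andbT; case: eqP => [->|_] /=; first by rewrite mulr1n.
  by rewrite mulr0n rmorph0 mul0r.
rewrite exchange_big; apply: eq_bigr => p _ /=.
have pP : (vpow p < k.+1)%N by rewrite ltnS vpow_le.
by rewrite -big_mkcond (big_pred1 (Ordinal pP)) // => a; rewrite eq_sym.
Qed.

Lemma augmentation_monomial j A B : (A + B = k + j * d)%N ->
  exists v, veronese_val (augmentation (F := F) vgen v : veronese_type K d k) =
    x1 ^+ A * x2 ^+ B.
Proof.
elim: j A B => [|j IH] A B AB.
  have kA : (A < num_pow k 0)%N by rewrite /num_pow leq0n; lia.
  have pP : (Ordinal kA, set0) \in vbasis d k 0 by rewrite inE cards0.
  exists (delta_mx 0 (enum_rank_in pP (Ordinal kA, set0))).
  rewrite /augmentation (bigD1 (enum_rank_in pP (Ordinal kA, set0))) //=.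
  rewrite mxE !eqxx scale1r big1 ?addr0 => [|q qp]; last first.
    by rewrite mxE (negbTE qp) andbF scale0r.
  by rewrite /vpow enum_rankK_in //= (_ : (k - A = B)%N) //; lia.
(* Peel off the image of y_i with i as large as possible; A + B >= d then leaves enough factors
   x_2. *)
pose i := minn A d; have id : (i < d.+1)%N by rewrite ltnS geq_minr.
have iA : (i <= A)%N by apply: geq_minl.
have iB : (d - i <= B)%N by rewrite /i; nia.
have [|v vE] := IH (A - i)%N (B - (d - i))%N; first by nia.
exists ('X_(Ordinal id) *: v).
have -> : augmentation (F := F) vgen ('X_(Ordinal id) *: v) =
    'X_(Ordinal id) *: augmentation (F := F) vgen v.
  by rewrite /augmentation scaler_sumr; apply: eq_bigr => p _; rewrite mxE scalerA.
rewrite veronese_valZ vE comp_vmX /=.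
rewrite -[in RHS](subnKC iA) -[in RHS](subnKC iB) !exprD; ring.
Qed.

Lemma augmentation_surj (x : veronese K d k) :
  exists v, augmentation (F := F) vgen v = x.
Proof.
suff [v vE] : exists v, veronese_val (augmentation (F := F) vgen v : veronese_type K d k)
    = veronese_val x by exists v; apply: val_inj.
have augD v w : augmentation (F := F) vgen (v + w) =
    augmentation (F := F) vgen v + augmentation (F := F) vgen w.
  by rewrite /augmentation -big_split; apply: eq_bigr => p _; rewrite mxE scalerDl.
have augZ r v : augmentation (F := F) vgen (r *: v) = r *: augmentation (F := F) vgen v.
  by rewrite /augmentation scaler_sumr; apply: eq_bigr => p _; rewrite mxE scalerA.
pose p : {mpoly K[2]} := veronese_val (x : veronese_type K d k).
suff H (s : seq 'X_{1..2}) : all (fun m : 'X_{1..2} =>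
      (k <= mdeg m)%N && (d %| mdeg m - k)%N) s -> exists v,
    veronese_val (augmentation (F := F) vgen v : veronese_type K d k) =
    \sum_(m <- s) p@_m *: 'X_[m].
  have [v vE] := H _ (valP (x : veronese_type K d k)); exists v.
  by rewrite vE -mpolyE.
elim: s => [_|m s IH /= /andP[/andP[km dm] /IH [v vE]]].
  by exists 0; rewrite big_nil /augmentation big1 // => q _; rewrite mxE scale0r.
have [w wE] : exists w, veronese_val (augmentation (F := F) vgen w : veronese_type K d k) =
    'X_[m].
  have [|w wE] := @augmentation_monomial ((mdeg m - k) %/ d) (m ord0) (m ord_max).
    by rewrite divnK // subnKC // mdegE big_ord_recl big_ord1; congr (_ + m _)%N; apply: val_inj.
  exists w; rewrite wE !mpolyXn -mpolyXD; congr 'X_[_]; apply/mnmP=> i.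
    rewrite !mnmDE !mulmnE !mnm1E; case: (unliftP ord0 i) => [i' ->|->].
      by rewrite (_ : lift ord0 i' = ord_max) ?mul0n ?mul1n //; apply: val_inj; case: i' => [[]].
    by rewrite mul1n mul0n addn0.
exists ((p@_m)%:MP *: w + v); rewrite augD augZ big_cons.
by rewrite veronese_valD veronese_valZ vE wE comp_mpolyC mul_mpolyC.
Qed.

Lemma veronese_resolution : graded_free_resolution (veronese K d k) F.
Proof.
split=> [i p q e /= he|].
  apply/allP=> m /fc_diff_mdeg ->; apply/eqP; move: he; rewrite vdegS; lia.
split=> [i p q /=|]; first by rewrite vdegS; lia.
exists vgen; split=> [p|x|v|i v].
- by rewrite /= /vdeg leq0n mul0n addn0; apply: vgen_homog.
- exact: augmentation_surj.
- have -> : augmentation (F := F) vgen v = 0 <-> ev k (fam v) = 0.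
    rewrite -val_augmentation; split=> [->|h]; first exact: raddf0.
    by apply: val_inj; exact: h.
  split=> [h|[w ->]].
    have [bs bss bsE] := ev_exact d0 (fam_supported v) h.
    exists (unfam k 1 bs); rewrite mul_vdiff -[LHS]famK; apply: unfam_ext => a.
    by rewrite bsE; apply/esym/vdiff_ext/unfamK.
  rewrite mul_vdiff -(ev_vdiff0 (fam_supported w)) /ev; apply: eq_bigr => a _.
  by rewrite unfamK //; apply: vdiff_supported; apply: fam_supported.
- exact: vcomplex_exact.
Qed.

Lemma veronese_minimal : minimal F.
Proof.
move=> i p q; apply: memN_msupp_eq0; apply/negP => /fc_diff_mdeg.
by rewrite mdeg0.
Qed.

Lemma veronese_pure : pure F.
Proof. by exists (vdeg d k); split=> // i; rewrite vdegS; lia. Qed.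

End VeroneseResolution.

(** * Betti numbers from a minimal resolution *)

Section HomogeneousParts.
Variables (K : fieldType) (d : nat).
Local Notation R := {mpoly K[d.+1]}.
Implicit Types (r : R) (P Q : pred 'X_{1..d.+1}).

Definition mfilter P r : R := \sum_(m <- msupp r | P m) r@_m *: 'X_[m].

Lemma mcoeff_mfilter P r m : (mfilter P r)@_m = if P m then r@_m else 0.
Proof.
rewrite raddf_sum big_mkcond /=.
transitivity (\sum_(m' <- msupp r) (if P m then (r@_m' *: 'X_[m'])@_m else 0)).
  apply: eq_bigr => m' _; case: (eqVneq m' m) => [->//|m'm].
  by rewrite mcoeffZ mcoeffX (negbTE m'm) mulr0 !if_same.
case: ifP => _; last by rewrite big1.
by rewrite [r in RHS]mpolyE raddf_sum.
Qed.

Lemma mfilterD P r r' : mfilter P (r + r') = mfilter P r + mfilter P r'.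
Proof.
apply/mpolyP=> m; rewrite mcoeffD !mcoeff_mfilter mcoeffD.
by case: ifP => _; rewrite ?addr0.
Qed.

Lemma mfilter_0 P : mfilter P 0 = 0.
Proof. by apply/mpolyP=> m; rewrite mcoeff_mfilter mcoeff0 if_same. Qed.

Lemma mfilter_sum (I : Type) (s : seq I) P (f : I -> R) :
  mfilter P (\sum_(x <- s) f x) = \sum_(x <- s) mfilter P (f x).
Proof. exact: (big_morph _ (mfilterD P) (mfilter_0 P)). Qed.

Lemma mfilterC P r : r = mfilter P r + mfilter (predC P) r.
Proof.
apply/mpolyP=> m; rewrite mcoeffD !mcoeff_mfilter /=.
by case: (P m); rewrite ?addr0 ?add0r.
Qed.

Lemma mfilter_msupp P r m : m \in msupp (mfilter P r) -> P m.
Proof. by rewrite mcoeff_msupp mcoeff_mfilter; case: ifP; rewrite ?eqxx. Qed.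

Lemma mfilter_id P r : {in msupp r, forall m, P m} -> mfilter P r = r.
Proof.
move=> h; apply/mpolyP=> m; rewrite mcoeff_mfilter; case: ifPn => // Pm.
by rewrite memN_msupp_eq0 //; apply: contra Pm => /h.
Qed.

Lemma mfilter_none P r : {in msupp r, forall m, ~~ P m} -> mfilter P r = 0.
Proof.
move=> h; apply/mpolyP=> m; rewrite mcoeff_mfilter mcoeff0; case: ifP => // Pm.
by rewrite memN_msupp_eq0 //; apply/negP => /h; rewrite Pm.
Qed.

Lemma mfilterM P Q r r' :
  (forall m m', m' \in msupp r' -> P (m + m')%MM = Q m) ->
  mfilter P (r * r') = mfilter Q r * r'.
Proof.
move=> PQ; rewrite {1}(mfilterC Q r) mulrDl mfilterD.
rewrite [X in X + _ = _]mfilter_id ?[X in _ + X = _]mfilter_none ?addr0 // => m.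
  move=> /msuppM_le /allpairsP[[m1 m2] /= [h1 h2 ->]]; rewrite PQ //.
  exact: mfilter_msupp h1.
move=> /msuppM_le /allpairsP[[m1 m2] /= [h1 h2 ->]]; rewrite PQ //.
exact: mfilter_msupp h1.
Qed.

(* The matrix of a homomorphism of degree 0 between the free modules with       *)
(* basis degrees [dp] and [dq].                                                 *)
Definition graded m n (dp : 'I_m -> nat) (dq : 'I_n -> nat) (A : 'M[R]_(m, n)) :=
  forall p q mm, mm \in msupp (A p q) -> (d * mdeg mm + dq q = dp p)%N.

Lemma graded1 n (dp : 'I_n -> nat) : graded dp dp 1%:M.
Proof.
move=> p q mm; rewrite mxE; case: eqP => [->|_]; last by rewrite mulr0n msupp0.
by rewrite mulr1n msupp1 inE => /eqP ->; rewrite mdeg0 muln0.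
Qed.

Lemma gradedB m n (dp : 'I_m -> nat) (dq : 'I_n -> nat) (A B : 'M[R]_(m, n)) :
  graded dp dq A -> graded dp dq B -> graded dp dq (A - B).
Proof.
move=> hA hB p q mm; rewrite !mxE => /msuppB_le.
by rewrite mem_cat => /orP[/hA|/hB].
Qed.

Lemma gradedM m n l (dp : 'I_m -> nat) (dq : 'I_n -> nat) (dr : 'I_l -> nat)
    (A : 'M[R]_(m, n)) (B : 'M[R]_(n, l)) :
  graded dp dq A -> graded dq dr B -> graded dp dr (A *m B).
Proof.
move=> hA hB p r mm; rewrite mxE => /msupp_sum_le /flattenP[ms /mapP[q _ ->]].
move=> /msuppM_le /allpairsP[[m1 m2] /= [/hA <- /hB <- ->]].
by rewrite mdegD mulnDr addnA.
Qed.

Definition hpart m n (dp : 'I_m -> nat) (dq : 'I_n -> nat) (A : 'M[R]_(m, n)) :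
    'M[R]_(m, n) :=
  \matrix_(p, q) mfilter (fun mm => d * mdeg mm + dq q == dp p)%N (A p q).

Lemma hpart_graded m n (dp : 'I_m -> nat) (dq : 'I_n -> nat) (A : 'M[R]_(m, n)) :
  graded dp dq (hpart dp dq A).
Proof. by move=> p q mm; rewrite mxE => /mfilter_msupp /eqP. Qed.

Lemma hpart_id m n (dp : 'I_m -> nat) (dq : 'I_n -> nat) (A : 'M[R]_(m, n)) :
  graded dp dq A -> hpart dp dq A = A.
Proof.
move=> hA; apply/matrixP=> p q; rewrite mxE mfilter_id // => mm /hA /eqP.
by [].
Qed.

Lemma hpartM m n l (dp : 'I_m -> nat) (dq : 'I_n -> nat) (dr : 'I_l -> nat)
    (A : 'M[R]_(m, n)) (B : 'M[R]_(n, l)) :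
  graded dq dr B -> hpart dp dr (A *m B) = hpart dp dq A *m B.
Proof.
move=> hB; apply/matrixP=> p r; rewrite !mxE mfilter_sum; apply: eq_bigr => q _.
rewrite mxE; apply: mfilterM => m1 m2 /hB <-.
by rewrite mdegD mulnDr addnA.
Qed.

End HomogeneousParts.

(** * Graded lifts along a resolution *)

Section Comparison.
Variables (K : fieldType) (d : nat) (M : grmodule K d).
Local Notation R := {mpoly K[d.+1]}.
Implicit Types (F G : free_complex K d) (i j n : nat).

Definition outer_cycle F (eps : 'I_(fc_rank F 0) -> M) i :
    'rV[R]_(fc_rank F i) -> Prop :=
  match i with
  | 0 => fun v => augmentation eps v = 0
  | i'.+1 => fun v => v *m fc_diff F i' = 0
  end.

Definition resolves F (eps : 'I_(fc_rank F 0) -> M) : Prop :=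
  [/\ forall i, graded (@fc_deg _ _ F i.+1) (@fc_deg _ _ F i) (fc_diff F i),
      forall p, gr_comp (fc_deg p) (eps p),
      forall x : M, exists v, augmentation eps v = x
    & forall i v, outer_cycle eps v <-> exists w, v = w *m fc_diff F i].

Lemma resolvesP F : graded_free_resolution M F -> exists eps, @resolves F eps.
Proof.
move=> [hdeg [h0 [eps [heps hsurj haug hex]]]]; exists eps; split=> //.
  move=> i p q mm; case: (ltnP (fc_deg p) (fc_deg q)) => hpq.
    by rewrite h0 // msupp0.
  have /allP h := hdeg i p q _ (subnK hpq).
  by move=> /h /eqP ->; rewrite subnK.
by case=> [|i]; [exact: haug|exact: hex].
Qed.

Lemma augmentation_mul F (eps : 'I_(fc_rank F 0) -> M) m (A : 'M[R]_(m, fc_rank F 0))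
    (v : 'rV[R]_m) :
  augmentation eps (v *m A) = \sum_p v 0 p *: augmentation eps (row p A).
Proof.
rewrite /augmentation; under eq_bigr do rewrite mxE scaler_suml.
rewrite exchange_big; apply: eq_bigr => p _; rewrite scaler_sumr.
by apply: eq_bigr => q _; rewrite mxE scalerA.
Qed.

Lemma gr_comp_big (I : Type) (s : seq I) j (f : I -> M) :
  (forall x, gr_comp j (f x)) -> gr_comp j (\sum_(x <- s) f x).
Proof.
move=> hf; elim/big_rec: _ => [|x y _ hy]; first exact: gr_comp0.
by rewrite -[y]opprK -[- y]sub0r; do 2 apply: gr_compB => //; apply: gr_comp0.
Qed.

Section Lifting.
Variables (F : free_complex K d) (eps : 'I_(fc_rank F 0) -> M).
Hypothesis F_res : resolves eps.
Local Notation deg i := (@fc_deg _ _ F i).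

(** Exactness lifts each row somehow; as the differential is graded, the part of the right degree is
    still a lift. *)
Lemma lift_rows i n (dp : 'I_n -> nat) (V : 'M[R]_(n, fc_rank F i)) :
  graded dp (deg i) V -> (forall p, outer_cycle eps (row p V)) ->
  exists2 W, graded dp (deg i.+1) W & V = W *m fc_diff F i.
Proof.
have [hF _ _ hex] := F_res; move=> hV hc.
have [f fE] := fin_all_exists (fun p => (hex i (row p V)).1 (hc p)).
exists (hpart dp (deg i.+1) (\matrix_p f p)); first exact: hpart_graded.
rewrite -(hpartM _ _ (hF i)) (_ : _ *m _ = V) ?hpart_id //.
by apply/row_matrixP=> p; rewrite row_mul rowK fE.
Qed.

(** A preimage is cut into its homogeneous parts; directness of the grading of M forces the part of
    degree [dp p] to map to [x p]. *)
Lemma lift_augmentation n (dp : 'I_n -> nat) (x : 'I_n -> M) :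
  (forall p, gr_comp (dp p) (x p)) ->
  exists2 V, graded dp (deg 0%N) V & forall p, augmentation eps (row p V) = x p.
Proof.
have [_ heps hsurj _] := F_res; move=> hx.
have [f fE] := fin_all_exists (fun p => hsurj (x p)).
pose A : 'M_(n, _) := \matrix_p f p.
exists (hpart dp (deg 0%N) A); first exact: hpart_graded.
move=> p; pose v := f p; pose h j : 'rV[R]_(fc_rank F 0) :=
  hpart (fun=> j) (deg 0%N) v.
have -> : row p (hpart dp (deg 0%N) A) = h (dp p).
  by apply/rowP=> q; rewrite !mxE.
have hcomp j : gr_comp j (augmentation eps (h j)).
  apply: gr_comp_big => q; rewrite mxE; case: (leqP (fc_deg q) j) => qj.
    rewrite -[j in gr_comp j](subnK qj); apply: gr_compZ => //.
    apply/allP=> m /mfilter_msupp; rewrite eq_sym => /eqP ->.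
    by rewrite addnK.
  rewrite mfilter_none ?scale0r; first exact: gr_comp0.
  by move=> m _; apply/eqP; lia.
(* N exceeds [dp p] and all degrees occurring in v. *)
pose N := (dp p + \max_q \max_(m <- msupp (v ord0 q)) (d * mdeg m + fc_deg q))%N.+1.
have sumh : \sum_(j < N) h j = v.
  apply/rowP=> q; rewrite summxE; apply/mpolyP=> m; rewrite raddf_sum /=.
  under eq_bigr do rewrite mxE mcoeff_mfilter.
  case: (boolP (m \in msupp (v 0 q))) => hm; last first.
    by rewrite (memN_msupp_eq0 hm) big1 // => j _; rewrite if_same.
  have hN : (d * mdeg m + fc_deg q < N)%N.
    rewrite ltnS; apply: leq_trans (leq_addl _ _); apply: leq_trans (leq_bigmax q).
    by apply: (leq_bigmax_seq (F := fun m => d * mdeg m + fc_deg q)%N).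
  by rewrite -big_mkcond (big_pred1 (Ordinal hN)).
have dN : (dp p < N)%N by rewrite ltnS leq_addr.
pose g j := augmentation eps (h j) - (if j == dp p then x p else 0).
have /(_ _ dN) : forall j, (j < N)%N -> g j = 0.
  apply: gr_comp_direct => [j|].
    by apply: gr_compB => //; case: eqP => [->|_]; [exact: hx|exact: gr_comp0].
  rewrite sumrB -big_mkcond (big_pred1 (Ordinal dN)) //.
  rewrite -fE -/v -[in X in _ - X]sumh; apply/eqP; rewrite subr_eq0; apply/eqP.
  rewrite /augmentation exchange_big; apply: eq_bigr => q _ /=.
  by rewrite -scaler_suml summxE.
by rewrite /g eqxx => /eqP; rewrite subr_eq0 => /eqP.
Qed.

Lemma diff_diff i : fc_diff F i.+1 *m fc_diff F i = 0.
Proof.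
have [_ _ _ hex] := F_res; apply/row_matrixP=> p; rewrite row_mul row0.
by apply/(hex i.+1); exists (delta_mx 0 p); rewrite rowE.
Qed.

Lemma augmentation_diff p : augmentation eps (row p (fc_diff F 0)) = 0.
Proof.
have [_ _ _ hex] := F_res.
by apply/(hex 0%N); exists (delta_mx 0 p); rewrite rowE.
Qed.

End Lifting.
End Comparison.

(** * Chain maps and homotopies *)

Section ChainLifts.
Variables (K : fieldType) (d : nat) (M : grmodule K d).
Local Notation R := {mpoly K[d.+1]}.
Implicit Types (i : nat).

(* [A] is the i-th component of a chain map of graded complexes lifting the     *)
(* identity of [M] ([c = true]) or the zero endomorphism ([c = false]).         *)
Fixpoint chain_lift (F G : free_complex K d) (eF : 'I_(fc_rank F 0) -> M)
    (eG : 'I_(fc_rank G 0) -> M) (c : bool) i : 'M[R]_(fc_rank F i, fc_rank G i) -> Prop :=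
  match i with
  | 0 => fun A => graded (@fc_deg _ _ F 0) (@fc_deg _ _ G 0) A /\
      forall p, augmentation eG (row p A) = if c then eF p else 0
  | i'.+1 => fun A => graded (@fc_deg _ _ F i'.+1) (@fc_deg _ _ G i'.+1) A /\
      exists A', chain_lift eF eG c A' /\ A *m fc_diff G i' = fc_diff F i' *m A'
  end.

Section TwoComplexes.
Variables (F G : free_complex K d) (eF : 'I_(fc_rank F 0) -> M) (eG : 'I_(fc_rank G 0) -> M).
Hypotheses (F_res : resolves eF) (G_res : resolves eG).

Lemma chain_lift_graded c i A : chain_lift eF eG c A ->
  graded (@fc_deg _ _ F i) (@fc_deg _ _ G i) A.
Proof. by case: i A => [|i] A []. Qed.

Lemma chain_lift_step c i (A : 'M_(fc_rank F i, fc_rank G i)) : chain_lift eF eG c A ->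
  exists A1 : 'M_(fc_rank F i.+1, fc_rank G i.+1),
    chain_lift eF eG c A1 /\ A1 *m fc_diff G i = fc_diff F i *m A.
Proof.
have [hF _ _ _] := F_res; move=> hA.
have [|W gW VW] := lift_rows G_res (V := fc_diff F i *m A) (gradedM (hF i) (chain_lift_graded hA)).
  case: i A hA => [|i] A [gA hA] p; rewrite row_mul /=; last first.
    have [A' [_ AA']] := hA.
    by rewrite -mulmxA AA' mulmxA -row_mul (diff_diff F_res) row0 mul0mx.
  rewrite augmentation_mul; under eq_bigr do rewrite hA.
  case: c hA => hA; last by rewrite big1 // => q _; rewrite scaler0.
  exact: (augmentation_diff F_res).
by exists W; split=> //; split=> //; exists A.
Qed.

Lemma chain_lift_exists i : exists A : 'M_(fc_rank F i, fc_rank G i), chain_lift eF eG true A.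
Proof.
elim: i => [|i [A /chain_lift_step [A1 [hA1 _]]]]; last by exists A1.
have [_ heps _ _] := F_res; have [V gV hV] := lift_augmentation G_res heps.
by exists V.
Qed.

Lemma chain_liftB i (A B : 'M_(fc_rank F i, fc_rank G i)) :
  chain_lift eF eG true A -> chain_lift eF eG true B -> chain_lift eF eG false (A - B).
Proof.
elim: i A B => [|i IH] A B [gA hA] [gB hB]; split; try exact: gradedB.
  move=> p; rewrite -[RHS](subrr (eF p)) -{1}hA -hB /augmentation -sumrB.
  by apply: eq_bigr => q _; rewrite !mxE scalerBl.
have [[A' [hA' EA]] [B' [hB' EB]]] := (hA, hB).
by exists (A' - B'); split; [exact: IH|rewrite mulmxBl EA EB mulmxBr].
Qed.

End TwoComplexes.

Lemma chain_lift1 (F : free_complex K d) (eF : 'I_(fc_rank F 0) -> M) i :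
  chain_lift eF eF true (1%:M : 'M_(fc_rank F i)).
Proof.
elim: i => [|i IH]; split; try exact: graded1.
  move=> p; rewrite /augmentation (bigD1 p) //= !mxE eqxx scale1r big1 ?addr0 // => q qp.
  by rewrite !mxE eq_sym (negbTE qp) scale0r.
by exists 1%:M; rewrite mul1mx mulmx1.
Qed.

Lemma chain_liftM (F G H : free_complex K d) (eF : 'I_(fc_rank F 0) -> M)
    (eG : 'I_(fc_rank G 0) -> M) (eH : 'I_(fc_rank H 0) -> M) i
    (A : 'M_(fc_rank F i, fc_rank G i)) (B : 'M_(fc_rank G i, fc_rank H i)) :
  chain_lift eF eG true A -> chain_lift eG eH true B -> chain_lift eF eH true (A *m B).
Proof.
elim: i A B => [|i IH] A B [gA hA] [gB hB]; split; try exact: gradedM gB.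
  move=> p; rewrite row_mul augmentation_mul; under eq_bigr do rewrite hB.
  exact: hA.
have [[A' [hA' EA]] [B' [hB' EB]]] := (hA, hB).
by exists (A' *m B'); split; [exact: IH hB'|rewrite -mulmxA EB mulmxA EA mulmxA].
Qed.

(** The usual homotopy for a lift of zero. Of the second term only its factorization through the
    outgoing differential is recorded, which makes it vanish on cycles after reduction. *)
Lemma chain_lift_null (F : free_complex K d) (eF : 'I_(fc_rank F 0) -> M) i
    (A : 'M_(fc_rank F i)) : resolves eF -> chain_lift eF eF false A ->
  exists (s : 'M_(fc_rank F i, fc_rank F i.+1)) (u : 'M_(fc_rank F i)),
    [/\ graded (@fc_deg _ _ F i) (@fc_deg _ _ F i.+1) s, A = s *m fc_diff F i + u
      & match i return 'M_(fc_rank F i) -> Prop with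
        | 0 => fun u => u = 0
        | i'.+1 => fun u => exists s', u = fc_diff F i' *m s'
        end u].
Proof.
move=> F_res; have [hF _ _ _] := F_res.
elim: i A => [|i IH] A [gA hA].
  have [s gs As] := lift_rows F_res gA hA.
  by exists s, 0; rewrite addr0.
have [A' [/IH [s' [u' [gs' EA' hu']]] EA]] := hA.
have du' : fc_diff F i *m u' = 0.
  case: i {IH A hA gA EA A' gs' s' EA'} u' hu' => [|i] u'; first by move->; rewrite mulmx0.
  by move=> [s'' ->]; rewrite mulmxA (diff_diff F_res) mul0mx.
have [|s gs As] := lift_rows F_res (gradedB gA (gradedM (hF i) gs')).
  move=> p; rewrite /= -row_mul mulmxBl EA -mulmxA -mulmxBr EA' addrAC subrr add0r.
  by rewrite du' row0.
exists s, (fc_diff F i *m s'); split=> //; last by exists s'.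
by rewrite -As subrK.
Qed.

End ChainLifts.

(** * Reduction modulo the variables *)

Section BettiNumbers.
Variables (K : fieldType) (d : nat) (M : grmodule K d).
Local Notation R := {mpoly K[d.+1]}.
Implicit Types (F G : free_complex K d) (i j : nat).

Local Notation bar := (map_mx (mcoeff 0%MM)).

Lemma bar_graded m n (dp : 'I_m -> nat) (dq : 'I_n -> nat) (A : 'M[R]_(m, n)) j :
  graded dp dq A ->
  diag_mx (\row_p (dp p == j)%:R) *m bar A = bar A *m diag_mx (\row_q (dq q == j)%:R) :> 'M[K]_(m, n).
Proof.
move=> hA; rewrite mul_diag_mx mul_mx_diag; apply/matrixP=> p q; rewrite !mxE.
case: (boolP (0%MM \in msupp (A p q))) => [/hA|/memN_msupp_eq0 ->].
  by rewrite mdeg0 muln0 add0n => <-; rewrite mulrC.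
by rewrite mulr0 mul0r.
Qed.

Lemma compK_idem F i j : compK F i j *m compK F i j = compK F i j.
Proof.
rewrite /compK mul_diag_mx; apply/matrixP=> p q; rewrite !mxE.
by case: eqP => _; rewrite ?mul1r // mul0r mul0rn.
Qed.

Lemma barM m n l (A : 'M[R]_(m, n)) (B : 'M[R]_(n, l)) : bar (A *m B) = bar A *m bar B.
Proof. exact: map_mxM. Qed.

(** The reduced differentials of G vanish, so the homotopy there becomes the equality [psi_phi].
    Hence reduced [phi] maps the cycles of degree j in F onto the degree j part of G, and the
    homotopy on F identifies its kernel on cycles with the boundaries among them; rank-nullity
    concludes. *)
Lemma dim_homologyK_minimal F G i j : graded_free_resolution M F ->
  graded_free_resolution M G -> minimal G -> dim_homologyK F i j = \rank (compK G i j).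
Proof.
move=> /resolvesP[eF F_res] /resolvesP[eG G_res] G_min.
have dG n : bar (fc_diff G n) = 0.
  by apply/matrixP=> p q; rewrite !mxE; apply: G_min.
have [phi hphi] := chain_lift_exists F_res G_res i.
have [psi hpsi] := chain_lift_exists G_res F_res i.
have [s [u [gs EF hu]]] := chain_lift_null F_res
  (chain_liftB (chain_lift1 eF i) (chain_liftM hphi hpsi)).
have [t [w [_ EG hw]]] := chain_lift_null G_res
  (chain_liftB (chain_lift1 eG i) (chain_liftM hpsi hphi)).
have [X uX] : exists X, bar u = diffK_out F i *m X.
  clear -hu; case: i u hu => [|n] u' => [->|[s' ->]]; first by exists 0; rewrite map_mx0 mulmx0.
  by exists (bar s'); rewrite barM.
have out_psi : bar psi *m diffK_out F i = 0.
  clear -hpsi dG; case: i psi hpsi => [|n] psi'; first by rewrite /= mulmx0.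
  by move=> [_ [A' [_ E]]]; rewrite /= /diffK -barM E barM dG mul0mx.
have d_phi : diffK F i *m bar phi = 0.
  have [A1 [_ E]] := chain_lift_step F_res G_res hphi.
  by rewrite /diffK -barM -E barM dG mulmx0.
have psi_phi : bar psi *m bar phi = 1%:M.
  move/(congr1 (fun A => bar A)): EG; rewrite map_mxB map_mxD map_mx1 !barM dG mulmx0 add0r.
  have -> : bar w = 0.
    clear -hw dG; case: i w hw => [|n] w'; first by move->; rewrite map_mx0.
    by move=> [s' ->]; rewrite barM dG mul0mx.
  by move/eqP; rewrite subr_eq0 => /eqP <-.
have phi_psi : 1%:M = bar phi *m bar psi + bar s *m diffK F i + bar u.
  move/(congr1 (fun A => bar A)): EF; rewrite map_mxB map_mxD map_mx1 !barM.
  by move/eqP; rewrite subr_eq => /eqP ->; rewrite addrC addrA.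
have C_phi := bar_graded j (chain_lift_graded hphi).
have C_psi := bar_graded j (chain_lift_graded hpsi).
have C_s := bar_graded j gs.
rewrite -!/(compK _ _ _) in C_phi C_psi C_s.
set Z := cyclesK F i j; set B := boundariesK F i j.
have ZC : (Z <= compK F i j)%MS by apply: capmxSl.
have Zout : Z *m diffK_out F i = 0 by apply/sub_kermxP/capmxSr.
have subC n (Y : 'M_(n, _)) : (Y <= compK F i j)%MS -> Y *m compK F i j = Y.
  by move=> /submxP[Y' ->]; rewrite -mulmxA compK_idem.
have kerB : (Z :&: kermx (bar phi) <= B)%MS.
  set Y := (Z :&: _)%MS.
  have YZ : (Y <= Z)%MS by apply: capmxSl.
  have Yphi : Y *m bar phi = 0 by apply/sub_kermxP/capmxSr.
  have Yout : Y *m diffK_out F i = 0.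
    by have /submxP[Y' ->] := YZ; rewrite -mulmxA Zout mulmx0.
  (* Of the three terms of [phi_psi] only the one through s survives, and [C_s] keeps it in degree
     j. *)
  rewrite -[X in (X <= _)%MS]mulmx1 phi_psi uX !mulmxDr !mulmxA Yphi Yout !mul0mx.
  rewrite add0r addr0 -{1}(subC _ _ (submx_trans YZ ZC)) -(mulmxA Y) C_s.
  by rewrite mulmxA -mulmxA submxMl.
have Bker : (B <= kermx (bar phi))%MS.
  by apply/sub_kermxP; rewrite /B /boundariesK -mulmxA d_phi mulmx0.
have rank_cap : \rank (Z :&: B) = \rank (Z :&: kermx (bar phi)).
  apply/eqP; rewrite eqn_leq; apply/andP; split; apply: mxrankS; first exact: capmxS.
  by rewrite sub_capmx capmxSl kerB.
have rank_im : \rank (Z *m bar phi) = \rank (compK G i j).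
  apply/eqP; rewrite eqn_leq; apply/andP; split; apply: mxrankS.
    by rewrite -(subC _ _ ZC) -mulmxA C_phi mulmxA submxMl.
  rewrite -[X in (X <= _)%MS]mulmx1 -psi_phi mulmxA; apply: submxMr.
  rewrite sub_capmx; apply/andP; split; first by rewrite C_psi submxMl.
  by apply/sub_kermxP; rewrite -mulmxA out_psi mulmx0.
apply: (@addnI (\rank (Z :&: B))); rewrite /dim_homologyK mxrank_cap_compl.
by rewrite rank_cap -rank_im addnC mxrank_mul_ker.
Qed.

Lemma rank_compK G i j e : (forall p : 'I_(fc_rank G i), fc_deg p = e) ->
  \rank (compK G i j) = if e == j then fc_rank G i else 0%N.
Proof.
move=> he; rewrite /compK; have -> : \row_p (fc_deg p == j)%:R =
    const_mx (e == j)%:R :> 'rV[K]_(fc_rank G i) by apply/rowP=> p; rewrite !mxE he.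
rewrite diag_const_mx; case: eqP => _; first by rewrite mxrank1.
by rewrite -scalemx1 scale0r mxrank0.
Qed.

Lemma is_betti_pure G i j e : graded_free_resolution M G -> minimal G ->
  (forall p : 'I_(fc_rank G i), fc_deg p = e) ->
  is_betti M i j (if e == j then fc_rank G i else 0%N).
Proof.
move=> G_res G_min he; split; first by exists G.
by move=> F F_res; rewrite (dim_homologyK_minimal i j F_res G_res G_min) (rank_compK j he).
Qed.

Lemma is_total_betti_pure G i e : graded_free_resolution M G -> minimal G ->
  (forall p : 'I_(fc_rank G i), fc_deg p = e) -> is_total_betti M i (fc_rank G i).
Proof.
move=> G_res G_min he; exists (fun j => if e == j then fc_rank G i else 0%N), e.+1; split.
- by move=> j; apply: is_betti_pure.
- by move=> j ej; rewrite ltn_eqF.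
by rewrite -big_mkcond (big_pred1 ord_max) // => j; rewrite eq_sym.
Qed.

End BettiNumbers.

Theorem theorem4p1 (K : fieldType) (d k : nat) (hd : (1 <= d)%N) (hk : (k < d)%N) :
  has_pure_minimal_resolution (veronese K d k) /\
  (forall i : nat, (i <= k)%N ->
     is_total_betti (veronese K d k) i ((k + 1 - i) * 'C(d, i))%N /\
     is_betti (veronese K d k) i (k + i * d)%N ((k + 1 - i) * 'C(d, i))%N) /\
  (forall i : nat, (k < i)%N ->
     is_total_betti (veronese K d k) i ((i - k) * 'C(d, i.+1))%N /\
     is_betti (veronese K d k) i (k + i.+1 * d)%N ((i - k) * 'C(d, i.+1))%N) /\
  (forall i : nat, (d <= i)%N -> is_total_betti (veronese K d k) i 0%N).
Proof.
have res := veronese_resolution K k hd; have min : minimal (veronese_complex K d k) by exact: veronese_minimal.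
have total i : is_total_betti (veronese K d k) i (vrank d k i).
  exact: is_total_betti_pure res min (fun=> erefl (vdeg d k i)).
have betti i : is_betti (veronese K d k) i (vdeg d k i) (vrank d k i).
  have := is_betti_pure (vdeg d k i) res min (fun _ : 'I_(vrank d k i) => erefl (vdeg d k i)).
  by rewrite eqxx.
split; first by exists (veronese_complex K d k); split=> //; apply: veronese_pure.
split=> [i ik|].
  by move: (total i) (betti i); rewrite vrankE /num_pow /ext_deg /vdeg ik addn1.
split=> [i ki|i di].
  by move: (total i) (betti i); rewrite vrankE /num_pow /ext_deg /vdeg leqNgt ki.
(* Now k < d <= i, so the exterior degree i + 1 exceeds d. *)
by move: (total i); rewrite vrankE /ext_deg leqNgt (leq_trans hk di) bin_small ?muln0.
Qed.
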